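(* Let $\{M_1(t)\}_{t\ge0},\{M_2(t)\}_{t\ge0},\dots$ be a countably infinite collection of independent GCPs such that, for each $i\ge1$, $\{M_i(t)\}_{t\ge0}$ performs jumps of amplitude $1,2,\dots,k_i$ with positive rates $\lambda_1^{(i)},\lambda_2^{(i)},\dots,\lambda_{k_i}^{(i)}$, respectively. Put $\lambda_j^{(i)}=0$ for $j>k_i$. Assume $k_1\le k_2\le k_3\le\cdots$ and $K:=\max\{k_1,k_2,\dots\}<\infty$. For $1\le j\le K$ let $$\beta_j=\sum_{i=1}^{\infty}\lambda_j^{(i)} .$$ If $\beta_j<\infty$ for all $1\le j\le K$, then for any fixed $t\ge0$ the series $\mathscr{M}^\infty(t):=\sum_{i=1}^{\infty}M_i(t)$ converges with probability $1$; moreover, $\{\mathscr{M}^\infty(t)\}_{t\ge0}$ is a GCP which performs $K$ kinds of jumps of amplitude $1,2,\dots,K$ with corresponding rates $\beta_1,\beta_2,\dots,\beta_K$. If $\beta_j$ diverges for some $1\le j\le K$, then for every fixed $t>0$ the series $\mathscr{M}^\infty(t)$ diverges with probability $1$.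
   Context: A counting process is an $\mathbb{N}_0$-valued process with nondecreasing right-continuous paths ($\mathbb{N}_0=\{0,1,2,\dots\}$). A generalized counting process (GCP) performing $k$ kinds of jumps of amplitude $1,2,\dots,k$ with positive rates $\lambda_1,\dots,\lambda_k$ is a counting process $\{M(t)\}_{t\ge0}$ with $M(0)=0$ and independent and stationary increments such that, as $h\to0^+$, $\mathrm{Pr}\{M(t+h)=n+j\mid M(t)=n\}$ equals $1-\sum_{i=1}^k\lambda_i h+o(h)$ for $j=0$, $\lambda_jh+o(h)$ for $1\le j\le k$, and $o(h)$ for $j\ge k+1$. *)

(* Defs.v *)
From HB Require Import structures.
From mathcomp Require Import all_boot all_order all_algebra finmap.
From mathcomp Require Import all_classical all_reals all_analysis.
Import Order.TTheory GRing.Theory Num.Theory.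
Import numFieldNormedType.Exports.

Set Implicit Arguments.
Unset Strict Implicit.
Unset Printing Implicit Defensive.

Local Open Scope classical_set_scope.
Local Open Scope ring_scope.

Definition mutually_independent (d : measure_display) (T : measurableType d)
    (R : realType) (P : probability T R) (I : choiceType)
    (F : I -> set (set T)) : Prop :=
  forall (J : {fset I}) (A : I -> set T),
    (forall i, i \in J -> F i (A i)) ->
    P (\bigcap_(i in [set` J]) A i) = (\prod_(i <- J) P (A i))%E.

Definition sigma_rv (T : Type) (X : T -> nat) : set (set T) :=
  preimage_set_system setT X measurable.

(* Processes are indexed by all of R, but only their values at times t >= 0
   are ever constrained or used. *)
Definition sigma_process (R : realType) (T : Type) (M : R -> T -> nat) :
    set (set T) :=
  <<s \bigcup_(t in [set t : R | 0 <= t]) sigma_rv (M t) >>.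

Definition independent_processes (d : measure_display) (T : measurableType d)
    (R : realType) (P : probability T R) (I : choiceType)
    (M : I -> R -> T -> nat) : Prop :=
  mutually_independent P (fun i => sigma_process (M i)).

(* nat carries its discrete topology. *)
Definition counting_process (d : measure_display) (T : measurableType d)
    (R : realType) (M : R -> T -> nat) : Prop :=
  [/\ forall t, 0 <= t -> measurable_fun setT (M t),
      forall w s t, 0 <= s -> s <= t -> (M s w <= M t w)%N
    & forall w t, 0 <= t -> M s w @[s --> t^'+] --> M t w].

(* The truncated subtraction of nat is the true difference here, because the
   paths of a counting process are nondecreasing. *)
Definition increment (R : realType) (T : Type) (M : R -> T -> nat) (s t : R) :
    T -> nat :=
  fun w => (M t w - M s w)%N.

Definition independent_increments (d : measure_display) (T : measurableType d)
    (R : realType) (P : probability T R) (M : R -> T -> nat) : Prop :=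
  forall t : nat -> R, 0 <= t 0%N -> (forall m, t m < t m.+1) ->
    mutually_independent P (fun m => sigma_rv (increment M (t m) (t m.+1))).

Definition stationary_increments (d : measure_display) (T : measurableType d)
    (R : realType) (P : probability T R) (M : R -> T -> nat) : Prop :=
  forall s t h : R, 0 <= s -> 0 <= t -> 0 <= h -> forall B : set nat,
    P (increment M s (s + h) @^-1` B) = P (increment M t (t + h) @^-1` B).

Definition cond_prob (d : measure_display) (T : measurableType d)
    (R : realType) (P : probability T R) (A B : set T) : R :=
  fine (P (A `&` B)) / fine (P B).

Definition is_o_h (R : realType) (f : R -> R) : Prop :=
  let F := (0 : R)^'+ in f =o_F (fun h : R => h).

(* The transition asymptotics are required for those (t, n) for which the
   conditioning event {M(t) = n} has positive probability. *)
Definition gcp (d : measure_display) (T : measurableType d) (R : realType)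
    (P : probability T R) (k : nat) (rate : nat -> R) (M : R -> T -> nat) :
    Prop :=
  let trans t n j h :=
    cond_prob P [set w | M (t + h) w = (n + j)%N] [set w | M t w = n] in
  [/\ (0 < k)%N /\ (forall j, (1 <= j <= k)%N -> 0 < rate j),
      counting_process M /\ (forall w, M 0 w = 0%N),
      independent_increments P M,
      stationary_increments P M
    & forall (t : R) (n : nat), 0 <= t -> P [set w | M t w = n] != 0%E ->
      [/\ is_o_h (fun h =>
             trans t n 0%N h - (1 - (\sum_(1 <= i < k.+1) rate i) * h)),
          forall j, (1 <= j <= k)%N ->
            is_o_h (fun h => trans t n j h - rate j * h)
        & forall j, (k < j)%N -> is_o_h (trans t n j)]].

(* Main.v *)
(* Write Lam_i for the total rate of M_i and B for the sum of all Lam_i.  From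
   P(M_i(t) = 0) = P(M_i(t/n) = 0)^n and the asymptotics at 0 one gets
   P(M_i(t) > 0) <= Lam_i t and P(M_i(t) = 0) <= exp(- Lam_i t / 2).

   If B is finite, the event that some M_i(t) with i >= n is nonzero has
   probability at most t times a tail of the series of the Lam_i.  Hence almost
   surely, for all t at once, only finitely many M_i(t) are nonzero, and the
   limit N inherits its path properties from finite sums.  The law of the
   increments of a partial sum is a convolution determined by the laws of the
   increments of the M_i, and the vector of its increments has the product law;
   both facts pass to the limit.  For the jump rates, P(N(h) = 0) >= 1 - B h,
   while looking at the event that exactly one M_i jumps gives
   P(N(h) = j) >= (beta_j - e) h for small h and 1 <= j <= K.  Since B is the
   sum of the beta_j and probabilities add up to at most 1, these one-sided
   bounds are all asymptotically sharp.

   If some beta_j is infinite, so is B, and the product of the exponential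
   bounds over i >= n vanishes: almost surely infinitely many M_i(t) are
   nonzero, so the terms of the series do not tend to 0. *)

Require Import Defs.
From HB Require Import structures.
From mathcomp Require Import all_boot all_order all_algebra finmap.
From mathcomp Require Import all_classical all_reals all_analysis.
From mathcomp Require Import ring lra.
Import Order.TTheory GRing.Theory Num.Theory.
Import numFieldNormedType.Exports.

Set Implicit Arguments.
Unset Strict Implicit.
Unset Printing Implicit Defensive.

Local Open Scope classical_set_scope.
Local Open Scope ring_scope.

(** * Real-valued probabilities of events *)

Section Probability.
Context (R : realType) (d : measure_display) (T : measurableType d).
Context (P : probability T R).

Definition prob (A : set T) : R := fine (P A).

Local Notation pr := prob.

Lemma probE (A : set T) : measurable A -> P A = (pr A)%:E.
Proof. by move=> mA; rewrite /prob fineK// fin_num_measure. Qed.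

Lemma prob_ge0 (A : set T) : 0 <= pr A.
Proof. by rewrite fine_ge0. Qed.

Lemma probT : pr setT = 1.
Proof. by rewrite /prob probability_setT. Qed.

Lemma prob0 : pr set0 = 0.
Proof. by rewrite /prob measure0. Qed.

Lemma le_prob (A B : set T) : measurable A -> measurable B -> A `<=` B ->
  pr A <= pr B.
Proof.
by move=> mA mB AB; rewrite -lee_fin -!probE// le_measure// inE.
Qed.

Lemma prob_le1 (A : set T) : measurable A -> pr A <= 1.
Proof. by move=> mA; rewrite -probT le_prob. Qed.

Lemma probC (A : set T) : measurable A -> pr (~` A) = 1 - pr A.
Proof. by move=> mA; rewrite {1}/prob probability_setC// probE. Qed.

Lemma prob_sum (F : finType) (Q : pred F) (A : F -> set T) :
  (forall f, Q f -> measurable (A f)) -> trivIset [set f | Q f] A ->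
  pr (\bigcup_(f in [set f | Q f]) A f) = \sum_(f | Q f) pr (A f).
Proof.
move=> mA tA; have finQ : finite_set [set f | Q f] by exact: finite_finset.
rewrite {1}/prob measure_fin_bigcup// fsbig_finite//=.
rewrite (_ : fset_set _ = [fset f in F | Q f]%fset); last first.
  by apply/fsetP => f; rewrite in_fset_set// !inE/=; apply/idP/idP; rewrite ?inE.
rewrite big_fset/= big_enum_cond/=.
rewrite (eq_bigr (fun f => (pr (A f))%:E)); last by move=> f /mA/probE.
by rewrite sumEFin.
Qed.

Lemma probU (A B : set T) : measurable A -> measurable B -> [disjoint A & B] ->
  pr (A `|` B) = pr A + pr B.
Proof.
move=> mA mB /disj_setPS AB.
rewrite {1}/prob measureU//; last by apply/seteqP; split.
by rewrite fineD// fin_num_measure.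
Qed.

Lemma probID (A B : set T) : measurable A -> measurable B ->
  pr A = pr (A `&` B) + pr (A `&` ~` B).
Proof.
move=> mA mB; rewrite -probU//.
- by rewrite -setIUr setUv setIT.
- exact: measurableI.
- by apply: measurableI => //; exact: measurableC.
- by apply/disj_setPS => w [[_ ?] [_ ?]].
Qed.

(** Countable subadditivity; bounding real partial sums keeps extended-real series out of the later
    estimates. *)
Lemma prob_bigcup_le (A : nat -> set T) (x : R) : (forall n, measurable (A n)) ->
  (forall n, \sum_(i < n) pr (A i) <= x) -> pr (\bigcup_n A n) <= x.
Proof.
move=> mA Ax; have mU : measurable (\bigcup_n A n) by exact: bigcup_measurable.
rewrite -lee_fin -probE//.
have /le_trans := @measure_sigma_subadditive _ _ _ P _ _ mA mU (@subset_refl _ _).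
apply.
apply: lime_le; first exact: is_cvg_nneseries.
apply: nearW => n; rewrite big_mkord (eq_bigr (fun i : 'I_n => (pr (A i))%:E)).
  by rewrite sumEFin lee_fin; exact: Ax.
by move=> i _; exact: probE.
Qed.

(** [Y] takes countably many values, so sigma-additivity over the points of [B] carries the
    factorisation from singletons to arbitrary sets. *)
Lemma prob_preimage_factor (Y : T -> nat) (A : set T) (x : R) :
  measurable A -> measurable_fun setT Y -> 0 <= x ->
  (forall b, pr (A `&` Y @^-1` [set b]) = x * pr (Y @^-1` [set b])) ->
  forall B, pr (A `&` Y @^-1` B) = x * pr (Y @^-1` B).
Proof.
move=> mA mY x0 H B.
have mYB C : measurable (Y @^-1` C) by rewrite -[_ @^-1` _]setTI; exact: mY.
have YB : Y @^-1` B = \bigcup_(b in B) Y @^-1` [set b].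
  by apply/seteqP; split => [w Bw|w [b Bb /= ->]]//; exists (Y w).
have tr : trivIset B (fun b => Y @^-1` [set b]).
  by move=> i j _ _ [w [/= <- <-]].
apply: EFin_inj; rewrite EFinM -!probE//; last exact: measurableI.
rewrite YB setI_bigcupr measure_bigcup//; last 2 first.
- by move=> i _; exact: measurableI.
- exact: trivIset_setIl.
rewrite measure_bigcup// -nneseriesZl//.
apply: eq_eseriesr => b _.
suff : P (A `&` Y @^-1` [set b]) = (x%:E * P (Y @^-1` [set b]))%E by [].
rewrite !probE//; last exact: measurableI.
by rewrite H EFinM.
Qed.

End Probability.

(** * Independence and sums of nat-valued variables *)

Section Independence.
Context (R : realType) (d : measure_display) (T : measurableType d).
Context (P : probability T R).
Local Notation pr := (prob P).

Lemma measurable_preimage_nat (X : T -> nat) (B : set nat) :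
  measurable_fun setT X -> measurable (X @^-1` B).
Proof. by move=> mX; rewrite -[_ @^-1` _]setTI; exact: mX. Qed.

Lemma sigma_rvE (X : T -> nat) (A : set T) :
  sigma_rv X A <-> exists B, A = X @^-1` B.
Proof.
split=> [[B _ <-]|[B ->]]; first by exists B; rewrite setTI.
by exists B => //; rewrite setTI.
Qed.

(** Independence is stated over finite sets; duplicate-free lists make it usable on index
    intervals. *)
Lemma mutually_independent_seq (F : nat -> set (set T)) (s : seq nat)
    (A : nat -> set T) :
  (forall i B, F i B -> measurable B) -> mutually_independent P F ->
  uniq s -> (forall i, i \in s -> F i (A i)) ->
  pr (\bigcap_(i in [set` s]) A i) = \prod_(i <- s) pr (A i).
Proof.
move=> mF indF us FA; have ps : perm_eq [fset i in s]%fset s.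
  by apply: uniq_perm => // i; rewrite !inE.
have -> : [set` s] = [set` [fset i in s]%fset].
  by apply/seteqP; split => i /=; rewrite !inE.
rewrite {1}/prob indF => [|i]; last by rewrite !inE => /FA.
rewrite (perm_big _ ps)/= big_seq (eq_bigr (fun i => (pr (A i))%:E)).
  by rewrite prodEFin -big_seq.
by move=> i /FA/mF; exact: probE.
Qed.

Lemma mutually_independent_ord (F : nat -> set (set T)) (n : nat)
    (A : nat -> set T) :
  (forall i B, F i B -> measurable B) -> mutually_independent P F ->
  (forall i, F i (A i)) ->
  pr (\bigcap_(i < n) A i) = \prod_(i < n) pr (A i).
Proof.
move=> mF indF FA; rewrite -(big_mkord xpredT (fun i => pr (A i))).
rewrite -(mutually_independent_seq mF)// ?iota_uniq//.
congr (pr (\bigcap_(i in _) _)).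
by apply/seteqP; split => i /=; rewrite mem_index_iota.
Qed.

(* The singletons are replaced by arbitrary sets one coordinate at a time. *)
Lemma indep_points (Y : nat -> T -> nat) (r : nat) :
  (forall m, measurable_fun setT (Y m)) ->
  (forall c : nat -> nat, pr (\bigcap_(m < r) Y m @^-1` [set c m]) =
     \prod_(m < r) pr (Y m @^-1` [set c m])) ->
  forall B : nat -> set nat, pr (\bigcap_(m < r) Y m @^-1` B m) =
     \prod_(m < r) pr (Y m @^-1` B m).
Proof.
move=> mY H B; have mYB m C := measurable_preimage_nat C (mY m).
suff main s : forall B : nat -> set nat,
    (forall m, (s <= m)%N -> exists b, B m = [set b]) ->
    pr (\bigcap_(m < r) Y m @^-1` B m) = \prod_(m < r) pr (Y m @^-1` B m).
  (* Coordinates from [r] on do not enter the intersection; padding them with a singleton makes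
     [main] applicable at [s = r]. *)
  pose B' m := if (m < r)%N then B m else [set 0%N].
  have /main : forall m, (r <= m)%N -> exists b, B' m = [set b].
    by move=> m rm; exists 0%N; rewrite /B' ltnNge rm.
  rewrite (eq_bigcapr (G := fun m => Y m @^-1` B m)) => [->|m /= mr].
    by apply: eq_bigr => m _; rewrite /B' ltn_ord.
  by rewrite /B' mr.
elim: s => {B} [|s IH] B Bs.
  have [c Bc] : {c : nat -> nat & forall m, B m = [set c m]}.
    exists (fun m => projT1 (cid (Bs m (leq0n m)))) => m.
    by case: cid.
  by under eq_bigcapr do rewrite Bc; under eq_bigr do rewrite Bc.
have [rs|sr] := leqP r s.
  pose B' m := if (m < r)%N then B m else [set 0%N].
  have /IH : forall m, (s <= m)%N -> exists b, B' m = [set b].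
    by move=> m sm; exists 0%N; rewrite /B' ltnNge (leq_trans rs sm).
  rewrite (eq_bigcapr (G := fun m => Y m @^-1` B m)) => [->|m /= mr].
    by apply: eq_bigr => m _; rewrite /B' ltn_ord.
  by rewrite /B' mr.
(* [A] and [x] freeze every coordinate but [s]; in the remaining set the identity has the form
   treated by [prob_preimage_factor]. *)
pose A := \bigcap_(m in [set m | (m < r)%N /\ m != s]) Y m @^-1` B m.
pose x := \prod_(m < r | m != Ordinal sr) pr (Y m @^-1` B m).
have splitE b : \bigcap_(m < r) Y m @^-1` (if m == s then b else B m) =
    A `&` Y s @^-1` b.
  apply/seteqP; split => [w Hw|w [Aw bw] m /= mr].
    split; last by have := Hw s sr; rewrite eqxx.
    by move=> m [/= mr ms]; have := Hw m mr; rewrite (negbTE ms).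
  by have [->//|ms] := eqVneq m s; apply: Aw; split.
have prodE b : \prod_(m < r) pr (Y m @^-1` (if m == s :> nat then b else B m)) =
    x * pr (Y s @^-1` b).
  rewrite (bigD1 (Ordinal sr))//= eqxx mulrC; congr (_ * _).
  by apply: eq_bigr => m; rewrite -val_eqE/= => /negbTE ->.
have BE m : B m = if m == s then B s else B m by case: eqP => [->|].
under eq_bigcapr do rewrite BE.
under eq_bigr do rewrite BE.
rewrite splitE prodE.
apply: (prob_preimage_factor (x := x)) => //.
- by apply: bigcap_measurableType => m _.
- by apply: prodr_ge0 => m _; exact: prob_ge0.
- move=> b; rewrite -splitE -prodE.
  apply: (IH (fun m => if m == s then [set b] else B m)) => m sm.
  by case: ifPn => [_|ms]; [exists b|apply: Bs; rewrite ltn_neqAle eq_sym ms].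
Qed.

(** Giving the indices outside [J] the full space, of probability 1, turns the finite family [J]
    into an initial segment. *)
Lemma mutually_independent_points (Y : nat -> T -> nat) :
  (forall m, measurable_fun setT (Y m)) ->
  (forall (r : nat) (c : nat -> nat),
     pr (\bigcap_(m < r) Y m @^-1` [set c m]) =
     \prod_(m < r) pr (Y m @^-1` [set c m])) ->
  mutually_independent P (fun m => sigma_rv (Y m)).
Proof.
move=> mY H J A JA.
have /choice[B AB] m : exists B, m \in J -> A m = Y m @^-1` B.
  have [/JA/sigma_rvE[B ->]|] := boolP (m \in J); first by exists B.
  by exists setT.
pose C m := if m \in J then B m else setT.
pose r := (\max_(m <- J) m).+1.
have Jr m : m \in J -> (m < r)%N by move=> mJ; rewrite ltnS; exact: leq_bigmax_seq.
have mA m : m \in J -> measurable (A m).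
  by move=> mJ; rewrite AB//; exact: measurable_preimage_nat.
have CE : \bigcap_(m in [set` J]) A m = \bigcap_(m < r) Y m @^-1` C m.
  apply/seteqP; split => [w Aw m /= _|w Cw m /= mJ].
    by rewrite /C; case: ifPn => // mJ; have := Aw m mJ; rewrite AB.
  by rewrite AB//; have := Cw m (Jr m mJ); rewrite /C mJ.
rewrite CE probE; last first.
  by apply: bigcap_measurableType => m _; exact: measurable_preimage_nat.
rewrite indep_points// -(big_mkord xpredT (fun m => pr (Y m @^-1` C m))).
rewrite (bigID (mem J))/= [X in _ * X]big1 ?mulr1; last first.
  by move=> m /negbTE mJ; rewrite /C mJ preimage_setT probT.
rewrite -big_filter (perm_big (enum_fset J)); last first.
  apply: uniq_perm => //; first by rewrite filter_uniq// iota_uniq.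
  move=> m; rewrite mem_filter mem_index_iota/=.
  by apply/andP/idP => [[]//|mJ]; split => //; exact: Jr.
rewrite big_seq [in RHS]big_seq -prodEFin; apply: eq_bigr => m mJ.
by rewrite /C mJ -AB// probE//; exact: mA.
Qed.

End Independence.

(** * Law of a partial sum of independent processes *)

Definition psum (T : Type) (X : nat -> T -> nat) (n : nat) (w : T) : nat :=
  (\sum_(i < n) X i w)%N.

Section SumLaw.
Context (R : realType) (d : measure_display) (T : measurableType d).
Context (P : probability T R).
Local Notation pr := (prob P).

(** Mass at [c] of the convolution of the first [n] laws [p i], starting from the Dirac mass at 0.
    It depends on one-dimensional laws only, which is how stationarity passes to sums. *)
Fixpoint convol (p : nat -> nat -> R) (n c : nat) : R :=
  if n is n'.+1 then \sum_(a < c.+1) convol p n' a * p n' (c - a)%N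
  else (c == 0%N)%:R.

Lemma eq_convol (p q : nat -> nat -> R) (n c : nat) :
  (forall i b, p i b = q i b) -> convol p n c = convol q n c.
Proof.
move=> pq; elim: n c => //= n IH c.
by apply: eq_bigr => a _; rewrite IH pq.
Qed.

Lemma measurable_psum (X : nat -> T -> nat) (n : nat) :
  (forall i, measurable_fun setT (X i)) -> measurable_fun setT (psum X n).
Proof.
move=> mX; elim: n => [|n IH].
  by rewrite (_ : psum X 0 = cst 0%N)//; apply/funext => w; rewrite /psum big_ord0.
move=> _ B _; rewrite setTI.
rewrite (_ : _ @^-1` _ = \bigcup_a (psum X n @^-1` [set a] `&`
    X n @^-1` [set b | B (a + b)%N])).
  apply: bigcup_measurable => a _.
  by apply: measurableI; exact: measurable_preimage_nat.
apply/seteqP; split => [w|w [a _ [/= <-]]];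
  rewrite /preimage/= /psum big_ord_recr//=.
by exists (psum X n w).
Qed.

(** [X i m] stands for increment number [m] of process [i]: [indF] is independence across processes,
    [pX] independence of the [r] increments within one process. *)
Context (F : nat -> set (set T)) (X : nat -> nat -> T -> nat) (r : nat).
Hypothesis mF : forall i B, F i B -> measurable B.
Hypothesis indF : mutually_independent P F.
Hypothesis mX : forall i m, measurable_fun setT (X i m).
Hypothesis FX : forall i (x : nat -> nat),
  F i (\bigcap_(m < r) X i m @^-1` [set x m]).
Hypothesis pX : forall i (x : nat -> nat),
  pr (\bigcap_(m < r) X i m @^-1` [set x m]) =
  \prod_(m < r) pr (X i m @^-1` [set x m]).

Let S n m := psum (fun i => X i m) n.
Let p m i b := pr (X i m @^-1` [set b]).

(* Besides the first n processes, the induction carries one arbitrary event for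
   each process not yet summed; the step uses it for the increments of process n. *)
Lemma prob_psum_indep (n N : nat) (A : nat -> set T) (c : nat -> nat) :
  (n <= N)%N -> (forall i, F i (A i)) ->
  pr (\bigcap_(m < r) S n m @^-1` [set c m] `&`
      \bigcap_(i in [set` index_iota n N]) A i) =
  (\prod_(m < r) convol (p m) n (c m)) * \prod_(n <= i < N) pr (A i).
Proof.
elim: n A c => [|n IH] A c nN FA.
  rewrite /= -(mutually_independent_seq mF indF (iota_uniq _ _))//.
  (* With nothing summed yet, the event on the sums is the whole space if every [c m] is 0 and empty
     otherwise. *)
  have [c0|] := boolP [forall m : 'I_r, c m == 0%N].
    rewrite big1 ?mul1r; last by move=> m _; rewrite (forallP c0 m).
    congr pr; apply/seteqP; split => [w []//|w Aw]; split => // m /= mr.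
    by rewrite /S /psum big_ord0; have /eqP := forallP c0 (Ordinal mr).
  rewrite negb_forall => /existsP[m cm0].
  rewrite (bigD1 m)//= (negbTE cm0) !mul0r -(@prob0 _ _ _ P).
  congr pr; apply/seteqP; split => // w [/(_ m (ltn_ord m))/=].
  by rewrite /S /psum big_ord0 => c0; rewrite -c0 in cm0.
(* Summands are natural numbers, so on the event every earlier partial sum is at most [C]. The
   vectors [a] of these sums thus form a finite type, over which the event is split. *)
pose C := (\max_(m < r) c m)%N.
have cC (m : 'I_r) : (c m <= C)%N by exact: leq_bigmax.
pose Q (a : {ffun 'I_r -> 'I_C.+1}) :=
  a \in family (fun m : 'I_r => [pred j : 'I_C.+1 | (j <= c m)%N]).
pose v (a : {ffun 'I_r -> 'I_C.+1}) m : nat :=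
  oapp (fun i => a i : nat) 0%N (insub m).
have vE a (m : 'I_r) : v a m = a m by rewrite /v valK.
(* The free event of process [n] is spent on requiring that its increments complete [a] to [c]. *)
pose A' a i :=
  if i == n then \bigcap_(m < r) X n m @^-1` [set (c m - v a m)%N] else A i.
have FA' a i : F i (A' a i) by rewrite /A'; case: eqP => // ->; exact: FX.
pose E a := \bigcap_(m < r) S n m @^-1` [set v a m] `&`
  \bigcap_(i in [set` index_iota n N]) A' a i.
have mS k m B : measurable (S k m @^-1` B).
  by apply: measurable_preimage_nat; apply: measurable_psum.
have mE a : measurable (E a).
  apply: measurableI; apply: bigcap_measurableType => // i _.
  exact: mF (FA' a i).
have -> : \bigcap_(m < r) S n.+1 m @^-1` [set c m] `&`
    \bigcap_(i in [set` index_iota n.+1 N]) A i = \bigcup_(a in [set a | Q a]) E a.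
  apply/seteqP; split => [w [Sw Aw]|w [a /= Qa [Sw Aw]]].
    pose a := [ffun m : 'I_r => inord (S n m w) : 'I_C.+1].
    have Sc (m : 'I_r) : (S n m w + X n m w)%N = c m.
      by have := Sw m (ltn_ord m); rewrite /S /psum/= big_ord_recr.
    have Sle (m : 'I_r) : (S n m w <= c m)%N by rewrite -Sc leq_addr.
    have va (m : 'I_r) : v a m = S n m w.
      by rewrite vE ffunE inordK// ltnS (leq_trans (Sle m)).
    exists a => /=.
      by apply/familyP => m; rewrite inE -vE va.
    split=> [m mr|i]; first by rewrite /= (va (Ordinal mr)).
    rewrite /= mem_index_iota /A' => /andP[ni iN]; case: eqP => [_ m mr|/eqP ine].
      by rewrite /= (va (Ordinal mr)) -(Sc (Ordinal mr)) addKn.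
    by apply: Aw; rewrite /= mem_index_iota iN ltn_neqAle eq_sym ine ni.
  split=> [m mr|i] /=.
    rewrite /S /psum big_ord_recr/= [X in (X + _)%N](Sw m mr).
    have nn : n \in index_iota n N by rewrite mem_index_iota leqnn.
    have := Aw n nn; rewrite /A' eqxx => /(_ m mr)/= ->.
    by rewrite subnKC// (vE _ (Ordinal mr)); have /familyP/(_ (Ordinal mr)) := Qa.
  rewrite mem_index_iota => /andP[ni iN].
  have := Aw i; rewrite /= mem_index_iota iN (ltnW ni)/= /A'.
  by rewrite gtn_eqF//; exact.
rewrite prob_sum//; last first.
  move=> a b _ _ [w [[Sa _] [Sb _]]]; apply/ffunP => m; apply/val_inj => /=.
  by rewrite -!vE -(Sa m (ltn_ord m)) (Sb m (ltn_ord m)).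
transitivity (\sum_(a | Q a)
    (\prod_(m < r) (convol (p m) n (a m) * p m n (c m - a m)%N)) *
    \prod_(n.+1 <= i < N) pr (A i)).
  apply: eq_bigr => a Qa; rewrite /E (IH (A' a))//; last exact: ltnW.
  rewrite big_ltn// {1}/A' eqxx pX mulrA -big_split/=; congr (_ * _).
    by apply: eq_bigr => m _; rewrite vE.
  by apply: eq_big_nat => i /andP[ni _]; rewrite /A' gtn_eqF.
rewrite -mulr_suml; congr (_ * _).
(* A sum over vectors of coordinatewise products is a product of sums, one convolution step per
   coordinate. *)
rewrite -(bigA_distr_big_dep _
  (fun (m : 'I_r) (j : 'I_C.+1) => convol (p m) n j * p m n (c m - j)%N)).
apply: eq_bigr => m _.
by rewrite [RHS]/= (big_ord_widen C.+1
  (fun j => convol (p m) n j * p m n (c m - j)%N)) ?ltnS//.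
Qed.

Lemma prob_psum (n : nat) (c : nat -> nat) :
  pr (\bigcap_(m < r) S n m @^-1` [set c m]) = \prod_(m < r) convol (p m) n (c m).
Proof.
have := prob_psum_indep c (leqnn n) (fun i => FX i c).
rewrite big_geq// mulr1 => <-; congr pr; apply/seteqP; split => [w Hw|w []//].
by split => // i /=; rewrite mem_index_iota ltnNge andbN.
Qed.

End SumLaw.

(** * A single generalized counting process *)

Section SmallO.
Context (R : realType).

Lemma is_o_hP (f : R -> R) : is_o_h f <->
  forall e, 0 < e -> exists2 x, 0 < x & forall h, 0 < h -> h < x -> `|f h| <= e * h.
Proof.
rewrite /is_o_h; split=> [/eqoP fo e e0|H].
  have := fo e e0; rewrite near_withinE => -[x /= x0 Hx].
  exists x => // h h0 hx.
  have := Hx h; rewrite /= sub0r normrN (gtr0_norm h0); exact.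
apply/eqoP => e e0; have [x x0 Hx] := H e e0.
rewrite near_withinE; exists x => //= h; rewrite /= sub0r normrN => hx h0.
by rewrite (gtr0_norm h0); apply: Hx => //; rewrite gtr0_norm in hx.
Qed.

End SmallO.

Section Gcp.
Context (R : realType) (d : measure_display) (T : measurableType d).
Context (P : probability T R).
Local Notation pr := (prob P).
Implicit Types M : R -> T -> nat.

Lemma measurable_increment M (s t : R) :
  measurable_fun setT (M s) -> measurable_fun setT (M t) ->
  measurable_fun setT (increment M s t).
Proof.
move=> ms mt _ B _; rewrite setTI.
rewrite (_ : _ @^-1` _ = \bigcup_a (M s @^-1` [set a] `&`
    M t @^-1` [set b | B (b - a)%N])).
  apply: bigcup_measurable => a _.
  by apply: measurableI; exact: measurable_preimage_nat.
by apply/seteqP; split => [w Bw|w [a _ [/= <-]]]//; exists (M s w).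
Qed.

(** Conditioning at time 0 is on the whole space, so the transition asymptotics there describe the
    law of [M h] itself. *)
Lemma cond_prob_at0 M (j : nat) (h : R) : (forall w, M 0 w = 0%N) ->
  cond_prob P [set w | M (0 + h) w = (0 + j)%N] [set w | M 0 w = 0%N] =
  pr (M h @^-1` [set j]).
Proof.
move=> M0; rewrite /cond_prob (_ : [set w | M 0 w = 0%N] = setT).
  by rewrite setIT probability_setT divr1 add0r add0n.
by apply/seteqP; split => // w _; exact: M0.
Qed.

Context (k : nat) (rate : nat -> R) (M : R -> T -> nat).
Hypothesis gcpM : gcp P k rate M.

Lemma gcp_measurable (t : R) : 0 <= t -> measurable_fun setT (M t).
Proof. by case: gcpM => _ [[mM _ _] _] _ _ _; exact: mM. Qed.

Lemma gcp_start (w : T) : M 0 w = 0%N.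
Proof. by case: gcpM => _ [_ M0] _ _ _. Qed.

Lemma gcp_monotone (w : T) (s t : R) : 0 <= s -> s <= t -> (M s w <= M t w)%N.
Proof. by case: gcpM => _ [[_ mM _] _] _ _ _; exact: mM. Qed.

Lemma gcp_right_continuous (w : T) (t : R) : 0 <= t ->
  M s w @[s --> t^'+] --> M t w.
Proof. by case: gcpM => _ [[_ _ mM] _] _ _ _; exact: mM. Qed.

Lemma gcp_increment0 (t : R) : increment M 0 t = M t.
Proof. by apply/funext => w; rewrite /increment gcp_start subn0. Qed.

Lemma gcp_stationary (t h : R) (B : set nat) : 0 <= t -> 0 <= h ->
  pr (increment M t (t + h) @^-1` B) = pr (M h @^-1` B).
Proof.
case: gcpM => _ _ _ st _ t0 h0; rewrite /prob (st t 0 h)//.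
by rewrite add0r gcp_increment0.
Qed.

Lemma gcp_rate_gt0 (j : nat) : (1 <= j <= k)%N -> 0 < rate j.
Proof. by case: gcpM => -[_ rate0] _ _ _ _; exact: rate0. Qed.

Let Lam := \sum_(1 <= i < k.+1) rate i.

Lemma gcp_total_rate_gt0 : 0 < Lam.
Proof.
have k0 : (0 < k)%N by case: gcpM => -[].
rewrite /Lam big_ltn//= ltr_pwDl ?gcp_rate_gt0 ?k0//.
rewrite big_nat_cond sumr_ge0// => i /andP[/andP[i1 ik] _].
by rewrite ltW// gcp_rate_gt0// (ltnW i1).
Qed.

Lemma gcp_asymp0 : is_o_h (fun h => pr (M h @^-1` [set 0%N]) - (1 - Lam * h)).
Proof.
case: gcpM => _ _ _ _ /(_ 0 0%N (lexx _)) [].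
  rewrite (_ : [set w | M 0 w = 0%N] = setT) ?probability_setT ?oner_eq0//.
  by apply/seteqP; split => // w _; exact: gcp_start.
move=> H _ _; congr is_o_h: H; apply/funext => h.
by rewrite cond_prob_at0//; exact: gcp_start.
Qed.

Lemma gcp_asymp (j : nat) : (1 <= j <= k)%N ->
  is_o_h (fun h => pr (M h @^-1` [set j]) - rate j * h).
Proof.
move=> jk; case: gcpM => _ _ _ _ /(_ 0 0%N (lexx _)) [].
  rewrite (_ : [set w | M 0 w = 0%N] = setT) ?probability_setT ?oner_eq0//.
  by apply/seteqP; split => // w _; exact: gcp_start.
move=> _ /(_ j jk) H _; congr is_o_h: H; apply/funext => h.
by rewrite cond_prob_at0//; exact: gcp_start.
Qed.

(** Cut the time interval into [n.+1] equal pieces. By monotonicity [M t] vanishes exactly when all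
    increments do, and these are independent with the same law. *)
Lemma gcp_zero_pow (t : R) (n : nat) : 0 < t ->
  pr (M t @^-1` [set 0%N]) = pr (M (t / n.+1%:R) @^-1` [set 0%N]) ^+ n.+1.
Proof.
move=> t0; pose u := t / n.+1%:R.
have u0 : 0 < u by rewrite divr_gt0.
(* [independent_increments] asks for an infinite increasing sequence, so the grid continues past
   [t], which is [s n.+1]. *)
pose s m : R := u *+ m.
have s0 m : 0 <= s m by rewrite mulrn_wge0// ltW.
have sS m : s m < s m.+1 by rewrite /s mulrS ltrDr.
have indM : mutually_independent P (fun m => sigma_rv (increment M (s m) (s m.+1))).
  by case: gcpM => _ _ ind _ _; exact: ind.
have mI m : measurable_fun setT (increment M (s m) (s m.+1)).
  by apply: measurable_increment; exact: gcp_measurable.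
have st : s n.+1 = t by rewrite /s /u -[_ *+ _]mulr_natr divfK// pnatr_eq0.
transitivity (pr (\bigcap_(m < n.+1) increment M (s m) (s m.+1) @^-1` [set 0%N])).
  congr pr; apply/seteqP; split => [w /= Mt m /= mn|w Hw /=].
    rewrite /increment; apply/eqP; rewrite subn_eq0.
    have /eqP -> : M (s m.+1) w == 0%N; last by [].
    rewrite -leqn0 -Mt -st; apply: gcp_monotone => //.
    by rewrite /s ler_wpMn2l// ltW.
  rewrite -st; have : (n.+1 <= n.+1)%N by [].
  elim: {-2}n.+1 => [_|m IH mn]; first by rewrite /s mulr0n gcp_start.
  have := Hw m mn; rewrite /= /increment IH ?subn0//; exact: ltnW.
rewrite (mutually_independent_ord _ _ indM); last 2 first.
- by move=> i B /sigma_rvE[C ->]; exact: measurable_preimage_nat.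
- by move=> i; apply/sigma_rvE; exists [set 0%N].
transitivity (\prod_(m < n.+1) pr (M u @^-1` [set 0%N])).
  apply: eq_bigr => m _; rewrite (_ : s m.+1 = s m + u); last by rewrite /s mulrSr.
  exact: (gcp_stationary _ (s0 m) (ltW u0)).
by rewrite prodr_const card_ord.
Qed.

Lemma gcp_small_step (t e : R) : 0 < t -> 0 < e -> exists n : nat,
  `|pr (M (t / n.+1%:R) @^-1` [set 0%N]) - (1 - Lam * (t / n.+1%:R))| <=
  e * (t / n.+1%:R).
Proof.
move=> t0 e0; have /is_o_hP/(_ e e0)[x x0 Hx] := gcp_asymp0.
(* Since [t / x] is below its truncation plus one, the step [t / n.+1%:R] is shorter than [x]. *)
exists (Num.truncn (t / x)); apply: Hx; first by rewrite divr_gt0.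
by rewrite ltr_pdivrMr// mulrC -ltr_pdivrMr// truncnS_gt.
Qed.

(** Bernoulli's inequality bounds [1 - q ^+ m] by [m%:R * (1 - q)], where [q] belongs to one short
    step. A relative error [e / t] per step adds up to [e] over all steps, and [e] is arbitrary. *)
Lemma gcp_nonzero_le (t : R) : 0 <= t ->
  pr (~` (M t @^-1` [set 0%N])) <= Lam * t.
Proof.
move=> t0; rewrite probC; last first.
  by apply: measurable_preimage_nat; exact: gcp_measurable.
have [->|tn0] := eqVneq t 0.
  rewrite mulr0 subr_le0 (_ : _ @^-1` _ = setT) ?probT//.
  by apply/seteqP; split => // w _; exact: gcp_start.
have {tn0} {}t0 : 0 < t by rewrite lt_neqAle eq_sym tn0.
apply/ler_addgt0Pr => e e0.
have e't : 0 < e / t by rewrite divr_gt0.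
have [n Hn] := gcp_small_step t0 e't.
rewrite (gcp_zero_pow n t0).
set q := pr _ in Hn *; set u := t / n.+1%:R in Hn.
have mq : measurable (M u @^-1` [set 0%N]).
  by apply: measurable_preimage_nat; apply: gcp_measurable; rewrite divr_ge0// ltW.
have q01 : 0 <= q <= 1 by rewrite prob_ge0 prob_le1.
have bern m : 1 - q ^+ m <= m%:R * (1 - q).
  elim: m => [|m IH]; first by rewrite expr0 subrr mul0r.
  have qm : q ^+ m <= 1 by case/andP: q01 => ? ?; rewrite exprn_ile1.
  by rewrite exprSr -natr1; nra.
apply: le_trans (bern _) _.
have uE : n.+1%:R * u = t by rewrite /u mulrC divfK// pnatr_eq0.
have -> : Lam * t + e = n.+1%:R * ((Lam + e / t) * u).
  by rewrite mulrCA uE mulrDl divfK// gt_eqF.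
rewrite ler_wpM2l//; move: Hn; rewrite ler_norml => /andP[+ _]; nra.
Qed.

(** Allowing half the rate as error, one short step [u] gives [q <= 1 - Lam / 2 * u], hence an
    exponential bound to be raised to the power. The lost factor 2 does not affect divergence of the
    summed rates. *)
Lemma gcp_zero_le (t : R) : 0 < t ->
  pr (M t @^-1` [set 0%N]) <= expR (- (Lam / 2 * t)).
Proof.
move=> t0; have L0 : 0 < Lam / 2 by rewrite divr_gt0// gcp_total_rate_gt0.
have [n Hn] := gcp_small_step t0 L0.
rewrite (gcp_zero_pow n t0).
set q := pr _ in Hn *; set u := t / n.+1%:R in Hn.
have uE : n.+1%:R * u = t by rewrite /u mulrC divfK// pnatr_eq0.
have -> : - (Lam / 2 * t) = n.+1%:R * - (Lam / 2 * u).
  by rewrite mulrN mulrCA uE.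
rewrite expRM_natl lerXn2r ?nnegrE ?prob_ge0 ?expR_ge0//.
apply: le_trans (expR_ge1Dx _).
by move: Hn; rewrite ler_norml => /andP[_]; nra.
Qed.

End Gcp.

(** * Superposition of independent processes *)

Section SigmaProcess.
Context (R : realType) (d : measure_display) (T : measurableType d).
Implicit Types M : R -> T -> nat.

Lemma sigma_process_measurable M (A : set T) :
  (forall t, 0 <= t -> measurable_fun setT (M t)) ->
  sigma_process M A -> measurable A.
Proof.
move=> mM; move: A; apply: smallest_sub; first exact: sigma_algebra_measurable.
move=> B [t t0 /sigma_rvE[C ->]]; exact: measurable_preimage_nat (mM t t0).
Qed.

(** Members of [sigma_process M] are the measurable sets of [T] under the generated sigma-algebra,
    so measurability of increments is applied in that space. *)
Lemma sigma_process_increment M (s t : R) (B : set nat) : 0 <= s -> 0 <= t ->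
  sigma_process M (increment M s t @^-1` B).
Proof.
move=> s0 t0.
pose G := \bigcup_(t in [set t : R | 0 <= t]) sigma_rv (M t).
have mM u : 0 <= u -> measurable_fun (setT : set (g_sigma_algebraType G)) (M u).
  move=> u0 _ C _; rewrite setTI; apply: sub_sigma_algebra.
  by exists u => //; apply/sigma_rvE; exists C.
exact: (measurable_preimage_nat B (measurable_increment (mM s s0) (mM t t0))).
Qed.

Lemma sigma_process_bigcap M (r : nat) (A : nat -> set T) :
  (forall m, sigma_process M (A m)) -> sigma_process M (\bigcap_(m < r) A m).
Proof.
move=> mA.
pose G := \bigcup_(t in [set t : R | 0 <= t]) sigma_rv (M t).
apply: (@bigcap_measurableType _ (g_sigma_algebraType G)) => m _; exact: mA.
Qed.

End SigmaProcess.

Section Superposition.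
Context (R : realType) (d : measure_display) (T : measurableType d).
Context (P : probability T R).
Local Notation pr := (prob P).
Context (M : nat -> R -> T -> nat) (k : nat -> nat) (lambda : nat -> nat -> R).
Hypothesis M_gcp : forall i, gcp P (k i) (lambda i) (M i).
Hypothesis M_indep : independent_processes P M.

Definition total_rate (i : nat) : R := \sum_(1 <= j < (k i).+1) lambda i j.
Local Notation Lam := total_rate.

Let mM i t : 0 <= t -> measurable_fun setT (M i t).
Proof. exact: (gcp_measurable (M_gcp i)). Qed.

Let mF i (A : set T) : sigma_process (M i) A -> measurable A.
Proof. by apply: sigma_process_measurable => t; exact: mM. Qed.

Lemma measurable_at i t (B : set nat) : 0 <= t -> measurable (M i t @^-1` B).
Proof. by move=> t0; apply: measurable_preimage_nat; exact: mM. Qed.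

Lemma sigma_process_at i t (B : set nat) : 0 <= t ->
  sigma_process (M i) (M i t @^-1` B).
Proof.
by move=> t0; rewrite -(gcp_increment0 (M_gcp i)); exact: sigma_process_increment.
Qed.

Lemma prob_psum_increments (t : nat -> R) (r n : nat) (c : nat -> nat) :
  0 <= t 0%N -> (forall m, t m < t m.+1) ->
  pr (\bigcap_(m < r)
        psum (fun i => increment (M i) (t m) (t m.+1)) n @^-1` [set c m]) =
  \prod_(m < r)
    convol (fun i b => pr (increment (M i) (t m) (t m.+1) @^-1` [set b])) n (c m).
Proof.
move=> t00 tS; have t0 m : 0 <= t m.
  by elim: m => // m; move/le_trans; apply; exact: ltW.
apply: (prob_psum (F := fun i => sigma_process (M i))
  (X := fun i m => increment (M i) (t m) (t m.+1))) => //.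
- by move=> i m; apply: measurable_increment; exact: mM.
- by move=> i x; apply: sigma_process_bigcap => m; exact: sigma_process_increment.
move=> i x; have [_ _ /(_ t t00 tS) indi _ _] := M_gcp i.
apply: (mutually_independent_ord _ _ indi) => m.
  move=> B /sigma_rvE[C ->]; apply: measurable_preimage_nat.
  by apply: measurable_increment; exact: mM.
by apply/sigma_rvE; exists [set x m].
Qed.

(** The case of a single column, [r = 1]. Stationarity of each process removes [s] from the
    right-hand side. *)
Lemma prob_psum_increment (s h : R) (n c : nat) : 0 <= s -> 0 <= h ->
  pr (psum (fun i => increment (M i) s (s + h)) n @^-1` [set c]) =
  convol (fun i b => pr (M i h @^-1` [set b])) n c.
Proof.
move=> s0 h0; have sh0 : 0 <= s + h by rewrite addr_ge0.
have one (A : nat -> set T) : \bigcap_(m < 1) A m = A 0%N.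
  by apply/seteqP; split => [w /(_ 0%N erefl)|w Aw [|]].
have := @prob_psum _ _ _ P (fun i => sigma_process (M i))
  (fun i _ => increment (M i) s (s + h)) 1%N mF M_indep.
move=> /(_ _ _ _ n (fun=> c)); rewrite one => ->; first last.
- by move=> i x; rewrite big_ord1 one.
- by move=> i x; rewrite one; exact: sigma_process_increment.
- by move=> i _; apply: measurable_increment; exact: mM.
rewrite big_ord1; apply: eq_convol => i b.
exact: (gcp_stationary (M_gcp i)).
Qed.

(** Joint and marginal probabilities are both expressed by the same convolutions. *)
Lemma prob_psum_increments_indep (t : nat -> R) (r n : nat) (c : nat -> nat) :
  0 <= t 0%N -> (forall m, t m < t m.+1) ->
  pr (\bigcap_(m < r)
        psum (fun i => increment (M i) (t m) (t m.+1)) n @^-1` [set c m]) =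
  \prod_(m < r)
    pr (psum (fun i => increment (M i) (t m) (t m.+1)) n @^-1` [set c m]).
Proof.
move=> t00 tS; rewrite prob_psum_increments//; apply: eq_bigr => m _.
have t0 l : 0 <= t l by elim: l => // l; move/le_trans; apply; exact: ltW.
have h0 : 0 <= t m.+1 - t m by rewrite subr_ge0 ltW.
have tE : t m.+1 = t m + (t m.+1 - t m) by rewrite addrC subrK.
rewrite tE prob_psum_increment//; apply: eq_convol => i b.
by rewrite (gcp_stationary (M_gcp i)).
Qed.

Definition tail_event (n : nat) (t : R) : set T :=
  \bigcup_i ~` (M (n + i)%N t @^-1` [set 0%N]).

Lemma tailP n t w : ~ tail_event n t w <-> forall i, (n <= i)%N -> M i t w = 0%N.
Proof.
split=> [nt i ni|H [i _ /=]]; last by apply; apply: H; rewrite leq_addr.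
by apply: contrapT => Mi; apply: nt; exists (i - n)%N => //=; rewrite subnKC.
Qed.

Lemma measurable_tail n t : 0 <= t -> measurable (tail_event n t).
Proof.
move=> t0; apply: bigcup_measurable => i _.
by apply: measurableC; exact: measurable_at.
Qed.

(** Union bound: each process moves with probability at most its rate times [t], and the rates from
    [n] on sum to at most [B] minus the first [n]. *)
Lemma prob_tail_le (n : nat) (t B : R) : 0 <= t ->
  (forall m, \sum_(i < m) Lam i <= B) ->
  pr (tail_event n t) <= (B - \sum_(i < n) Lam i) * t.
Proof.
move=> t0 LB; apply: prob_bigcup_le => [i|m].
  by apply: measurableC; exact: measurable_at.
apply: (@le_trans _ _ (\sum_(i < m) Lam (n + i)%N * t)).
  by apply: ler_sum => i _; exact: (gcp_nonzero_le (M_gcp _)).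
rewrite -mulr_suml ler_wpM2r// lerBrDl; apply: le_trans (LB (n + m)%N).
by rewrite big_split_ord.
Qed.

Lemma total_rate_gt0 i : 0 < Lam i.
Proof. exact: gcp_total_rate_gt0 (M_gcp i). Qed.

End Superposition.

(** * Comparing events and laws *)

Section TruncationError.
Context (R : realType) (d : measure_display) (T : measurableType d).
Context (P : probability T R).
Local Notation pr := (prob P).

Lemma probU_le (A B : set T) : measurable A -> measurable B ->
  pr (A `|` B) <= pr A + pr B.
Proof.
move=> mA mB; have mAC : measurable (~` A) by exact: measurableC.
have mAB : measurable (A `|` B) by exact: measurableU.
rewrite (probID _ mAB mA) lerD// le_prob//; try exact: measurableI.
by move=> w [[]].
Qed.

(** Outside [D] the two events coincide; inside, both parts have probability between 0 and that of
    [D]. *)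
Lemma prob_diff_le (E E' D : set T) :
  measurable E -> measurable E' -> measurable D ->
  (forall w, ~ D w -> (E w <-> E' w)) -> `|pr E - pr E'| <= pr D.
Proof.
move=> mE mE' mD H.
rewrite (probID _ mE mD) (probID _ mE' mD).
have -> : E `&` ~` D = E' `&` ~` D.
  by apply/seteqP; split => w [? Dw]; split => //; apply/H.
have leD F : measurable F -> pr (F `&` D) <= pr D.
  by move=> mF; apply: le_prob => //; exact: measurableI.
rewrite ler_norml; have := leD _ mE; have := leD _ mE'.
have := prob_ge0 P (E `&` D); have := prob_ge0 P (E' `&` D).
by move=> *; apply/andP; split; lra.
Qed.

Lemma prob_eq_law (X Y : T -> nat) :
  measurable_fun setT X -> measurable_fun setT Y ->
  (forall b, pr (X @^-1` [set b]) = pr (Y @^-1` [set b])) ->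
  forall B, pr (X @^-1` B) = pr (Y @^-1` B).
Proof.
move=> mX mY H B.
have split_law (Z : T -> nat) : measurable_fun setT Z ->
    P (Z @^-1` B) = (\sum_(b <oo | b \in B) (pr (Z @^-1` [set b]))%:E)%E.
  move=> mZ; have -> : Z @^-1` B = \bigcup_(b in B) Z @^-1` [set b].
    by apply/seteqP; split => [w Bw|w [b Bb /= ->]]//; exists (Z w).
  rewrite measure_bigcup//.
  - by apply: eq_eseriesr => b _; rewrite -probE//; exact: measurable_preimage_nat.
  - by move=> i _; exact: measurable_preimage_nat.
  - by move=> i j _ _ [w [/= <- <-]].
apply: EFin_inj; rewrite -!probE; try exact: measurable_preimage_nat.
by rewrite !split_law//; apply: eq_eseriesr => b _; rewrite H.
Qed.

End TruncationError.

Lemma psum_stable (T : Type) (X : nat -> T -> nat) (n m : nat) (w : T) :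
  (forall i, (n <= i)%N -> X i w = 0%N) -> (n <= m)%N -> psum X m w = psum X n w.
Proof.
move=> X0 /subnKC <-; rewrite /psum big_split_ord/= [X in (_ + X)%N]big1 ?addn0//.
by move=> i _; rewrite X0 ?leq_addr.
Qed.

(** Truncated subtraction distributes over the sum because every term is monotone. *)
Lemma psum_increment (R : realType) (T : Type) (M : nat -> R -> T -> nat)
    (s t : R) (n : nat) (w : T) :
  (forall i, (M i s w <= M i t w)%N) ->
  (psum (fun i => M i t) n w - psum (fun i => M i s) n w)%N =
  psum (fun i => increment (M i) s t) n w.
Proof. by move=> Mst; rewrite /psum sumnB. Qed.

(** * The limit process and its paths *)

Section Limit.
Context (R : realType) (d : measure_display) (T : measurableType d).
Context (P : probability T R).
Local Notation pr := (prob P).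
Context (M : nat -> R -> T -> nat) (k : nat -> nat) (lambda : nat -> nat -> R).
Hypothesis M_gcp : forall i, gcp P (k i) (lambda i) (M i).
Local Notation Lam := (total_rate k lambda).
Context (B : R).
Hypothesis Lam_cvg : \sum_(i < n) Lam i @[n --> \oo] --> B.

Lemma sum_total_rate_le n : \sum_(i < n) Lam i <= B.
Proof.
rewrite -(cvg_lim _ Lam_cvg)//.
apply: (nondecreasing_cvgn_le (u_ := fun n => \sum_(i < n) Lam i)); last first.
  by apply/cvg_ex; exists B.
apply/nondecreasing_seqP => m; rewrite big_ord_recr/= lerDl ltW//.
exact: (total_rate_gt0 M_gcp).
Qed.

Local Notation tail_event := (tail_event M).

Lemma prob_tail_cvg0 t : 0 <= t -> pr (tail_event n t) @[n --> \oo] --> (0 : R).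
Proof.
move=> t0.
apply: (@squeeze_cvgr _ _ _ _ (fun=> 0) (fun n => (B - \sum_(i < n) Lam i) * t)).
- apply: nearW => n; rewrite prob_ge0/=.
  exact: (prob_tail_le M_gcp _ t0 sum_total_rate_le).
- exact: cvg_cst.
- rewrite [X in _ --> X](_ : 0 = (B - B) * t); last by rewrite subrr mul0r.
  by apply: cvgM; [apply: cvgB; [exact: cvg_cst|exact: Lam_cvg]|exact: cvg_cst].
Qed.

(** Integer times suffice: by monotonicity, terms that vanish at an integer time vanish at all
    earlier ones. A countable intersection thus controls all times at once. *)
Definition good : set T := \bigcap_a \bigcup_n ~` tail_event n a%:R.

Lemma measurable_good : measurable good.
Proof.
apply: bigcapT_measurable => a; apply: bigcup_measurable => n _.
by apply: measurableC; exact: (measurable_tail M_gcp).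
Qed.

(** For each integer time the bad set lies in every tail event, and their probabilities tend to
    0. *)
Lemma prob_good : pr (~` good) = 0.
Proof.
apply/eqP; rewrite eq_le prob_ge0 andbT /good setC_bigcap.
have mC a : measurable (~` (\bigcup_n ~` tail_event n a%:R)).
  apply: measurableC; apply: bigcup_measurable => n _.
  by apply: measurableC; exact: (measurable_tail M_gcp).
apply: prob_bigcup_le => // n; rewrite big1// => a _.
apply/eqP; rewrite eq_le prob_ge0 andbT.
have a0 : (0 : R) <= a%:R by [].
have := prob_tail_cvg0 a0 => /(@cvg_lim _ _) <-//.
apply: limr_ge; first by apply/cvg_ex; exists 0; exact: prob_tail_cvg0.
apply: nearW => m; apply: le_prob => //; first exact: (measurable_tail M_gcp).
by rewrite setC_bigcup => w /(_ m Logic.I)/contrapT.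
Qed.

Lemma goodP w t : good w -> 0 <= t ->
  exists n, forall i, (n <= i)%N -> M i t w = 0%N.
Proof.
move=> gw t0; have [n _ /tailP Hn] := gw (Num.truncn t).+1 Logic.I.
exists n => i ni; apply/eqP; rewrite -leqn0 -(Hn i ni).
by apply: (gcp_monotone (M_gcp i)) => //; rewrite ltW// truncnS_gt.
Qed.

(* The pointwise sum of the M i, computed as a partial sum beyond which all the
   M i t w vanish; it is set to 0 on the null set where there may be none. *)
Definition superposition (t : R) (w : T) : nat :=
  if pselect (good w) then
    psum (fun i => M i t)
      (xget 0%N [set n | forall i, (n <= i)%N -> M i t w = 0%N]) w
  else 0%N.
Local Notation N := superposition.

(** Two indices beyond which all terms vanish yield the same partial sum, so the choice made by
    [xget] is immaterial. *)
Lemma superpositionE t w n : good w -> 0 <= t ->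
  (forall i, (n <= i)%N -> M i t w = 0%N) -> N t w = psum (fun i => M i t) n w.
Proof.
move=> gw t0 Hn; rewrite /superposition; case: pselect => // gw'.
set A := [set m | _]; have := @xgetPex _ 0%N A (ex_intro _ n Hn).
move: (xget _ _) => m /= Hm.
have [mn|nm] := leqP m n; first by rewrite (psum_stable _ mn).
by rewrite [LHS](psum_stable _ (ltnW nm)).
Qed.

Lemma superposition_bad t w : ~ good w -> N t w = 0%N.
Proof. by rewrite /superposition; case: pselect. Qed.

Lemma superposition_start w : N 0 w = 0%N.
Proof.
have [gw|] := pselect (good w); last exact: superposition_bad.
rewrite (superpositionE (n := 0))// => [|i _]; first by rewrite /psum big_ord0.
exact: (gcp_start (M_gcp i)).
Qed.

Lemma measurable_superposition t : 0 <= t -> measurable_fun setT (N t).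
Proof.
move=> t0 _ C _; rewrite setTI.
(* On bad points the value is 0, so they count entirely or not at all; good points are sorted by a
   valid cut-off [n]. *)
have -> : N t @^-1` C = (~` good `&` [set w | C 0%N]) `|` \bigcup_n
    (good `&` ~` tail_event n t `&` psum (fun i => M i t) n @^-1` C).
  apply/seteqP; split => [w Cw|w].
    have [gw|gw] := pselect (good w); last first.
      by left; split => //=; rewrite -(superposition_bad t gw).
    have [n Hn] := goodP gw t0; right; exists n => //.
    split; first by split => //; apply/tailP.
    by rewrite /= -superpositionE.
  move=> [[gw /= C0]|[n _ [[gw /tailP Hn]]]]/=.
    by rewrite superposition_bad.
  by rewrite (superpositionE gw t0 Hn).
apply: measurableU.
  apply: measurableI; first by apply: measurableC; exact: measurable_good.
  have [C0|C0] := pselect (C 0%N).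
    by rewrite (_ : [set _ | _] = setT)//; apply/seteqP; split.
  by rewrite (_ : [set _ | _] = set0)//; apply/seteqP; split.
apply: bigcup_measurable => n _; apply: measurableI.
  apply: measurableI; first exact: measurable_good.
  by apply: measurableC; exact: (measurable_tail M_gcp).
apply: measurable_preimage_nat; apply: measurable_psum => i.
exact: (gcp_measurable (M_gcp i)).
Qed.

Lemma vanish_le w s t n : 0 <= s -> s <= t ->
  (forall i, (n <= i)%N -> M i t w = 0%N) -> forall i, (n <= i)%N -> M i s w = 0%N.
Proof.
move=> s0 st Hn i ni; apply/eqP; rewrite -leqn0 -(Hn i ni).
exact: (gcp_monotone (M_gcp i)).
Qed.

(** A cut-off valid at [t + 1] serves all times from [t] to [t + 1]. There the process is a finite
    sum whose terms, being integer valued, are constant just after [t]. *)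
Lemma superposition_right_continuous (w : T) (t : R) : 0 <= t ->
  N s w @[s --> t^'+] --> N t w.
Proof.
move=> t0; have [gw|gw] := pselect (good w); last first.
  rewrite (_ : N ^~ w = cst 0%N).
    by rewrite superposition_bad//; exact: cvg_cst.
  by apply/funext => s; rewrite superposition_bad.
have t10 : 0 <= t + 1 by rewrite addr_ge0.
have [n Hn] := goodP gw t10.
suff Ht : \forall s \near t^'+, N s w = N t w.
  by move=> A /nbhs_singleton NA; apply: filterS Ht => s /= ->.
have t1 : t <= t + 1 by rewrite lerDl.
have NE s : t <= s -> s <= t + 1 -> N s w = psum (fun i => M i s) n w.
  move=> ts st; have s0 := le_trans t0 ts.
  exact: (superpositionE gw s0 (vanish_le s0 st Hn)).
have Mc : \forall s \near t^'+, forall i : 'I_n, M i s w = M i t w.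
  apply: filter_forall => i.
  exact: (gcp_right_continuous (M_gcp i) t0 (discrete_set1 (M i t w))).
near=> s; have ts : t < s by near: s; exact: nbhs_right_gt.
have st : s <= t + 1 by near: s; apply: nbhs_right_le; rewrite ltrDl.
rewrite (NE s (ltW ts) st) (NE t (lexx t) t1).
by apply: eq_bigr => i _; move: i; near: s.
Unshelve. all: by end_near.
Qed.

Lemma counting_superposition : counting_process N.
Proof.
split; first exact: measurable_superposition.
  move=> w s t s0 st.
  have [gw|gw] := pselect (good w); last by rewrite !superposition_bad.
  have t0 := le_trans s0 st; have [n Hn] := goodP gw t0.
  rewrite (superpositionE gw t0 Hn) (superpositionE gw s0 (vanish_le s0 st Hn)).
  by apply: leq_sum => i _; exact: (gcp_monotone (M_gcp i)).
by move=> w t t0; exact: superposition_right_continuous.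
Qed.

End Limit.

(** * Increments of the limit process *)

Section LimitIncrements.
Context (R : realType) (d : measure_display) (T : measurableType d).
Context (P : probability T R).
Local Notation pr := (prob P).
Context (M : nat -> R -> T -> nat) (k : nat -> nat) (lambda : nat -> nat -> R).
Hypothesis M_gcp : forall i, gcp P (k i) (lambda i) (M i).
Hypothesis M_indep : independent_processes P M.
Local Notation Lam := (total_rate k lambda).
Context (B : R).
Hypothesis Lam_cvg : \sum_(i < n) Lam i @[n --> \oo] --> B.
Local Notation tail_event := (tail_event M).
Local Notation good := (good M).
Local Notation N := (superposition M).

(** [E n] and [E'] can differ only on a tail event or on the null set of bad points. *)
Lemma prob_eventually_eq_cvg (E : nat -> set T) (E' : set T) (u : R) :
  0 <= u -> (forall n, measurable (E n)) -> measurable E' ->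
  (forall n w, good w -> (forall i, (n <= i)%N -> M i u w = 0%N) ->
    (E n w <-> E' w)) ->
  pr (E n) @[n --> \oo] --> pr E'.
Proof.
move=> u0 mE mE' EE'; apply/cvgrPdist_le => e e0.
have tail0 := prob_tail_cvg0 M_gcp Lam_cvg u0.
have : \forall n \near \oo, pr (tail_event n u) <= e.
  by move/cvgrPdist_le : tail0 => /(_ e e0); apply: filterS => n;
     rewrite sub0r normrN ger0_norm// prob_ge0.
apply: filterS => n; apply: le_trans.
have mt := measurable_tail M_gcp n u0; have mg := measurable_good M_gcp.
have mD := measurableU _ _ mt (measurableC mg).
rewrite distrC; apply: le_trans (prob_diff_le _ (mE n) mE' mD _) _.
  move=> w /not_orP[/tailP Hn /contrapT gw]; exact: EE'.
apply: le_trans (probU_le _ mt (measurableC mg)) _.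
by rewrite (prob_good M_gcp Lam_cvg) addr0.
Qed.

Lemma increment_superposition (s t : R) (n : nat) (w : T) : good w ->
  0 <= s -> s <= t -> (forall i, (n <= i)%N -> M i t w = 0%N) ->
  increment N s t w = psum (fun i => increment (M i) s t) n w.
Proof.
move=> gw s0 st Hn; rewrite /increment.
rewrite (superpositionE gw (le_trans s0 st) Hn).
rewrite (superpositionE gw s0 (vanish_le M_gcp s0 st Hn)).
by rewrite psum_increment// => i; exact: (gcp_monotone (M_gcp i)).
Qed.

Lemma measurable_increment_superposition (s t : R) : 0 <= s -> 0 <= t ->
  measurable_fun setT (increment N s t).
Proof.
move=> s0 t0; apply: measurable_increment;
exact: (measurable_superposition M_gcp).
Qed.

Lemma measurable_psum_increment (s t : R) n : 0 <= s -> 0 <= t ->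
  measurable_fun setT (psum (fun i => increment (M i) s t) n).
Proof.
move=> s0 t0; apply: measurable_psum => i; apply: measurable_increment.
  exact: (gcp_measurable (M_gcp i)).
exact: (gcp_measurable (M_gcp i)).
Qed.

Lemma increment_superposition_cvg (t : nat -> R) (r : nat) (c : nat -> nat) :
  0 <= t 0%N -> (forall m, t m < t m.+1) ->
  pr (\bigcap_(m < r)
        psum (fun i => increment (M i) (t m) (t m.+1)) n @^-1` [set c m])
    @[n --> \oo] -->
  pr (\bigcap_(m < r) increment N (t m) (t m.+1) @^-1` [set c m]).
Proof.
move=> t00 tS; have t0 m : 0 <= t m.
  by elim: m => // m; move/le_trans; apply; exact: ltW.
have tm : {homo t : m n / (m <= n)%N >-> m <= n}.
  by apply: homo_leq => // [x y z|m]; [exact: le_trans|exact: ltW].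
(* The last time [t r] is the horizon: a cut-off valid there is valid for all [r] increments. *)
apply: (@prob_eventually_eq_cvg _ _ (t r)) => //.
- move=> n; apply: bigcap_measurableType => m _; apply: measurable_preimage_nat.
  exact: measurable_psum_increment.
- apply: bigcap_measurableType => m _; apply: measurable_preimage_nat.
  exact: measurable_increment_superposition.
move=> n w gw Hn.
have E m : (m < r)%N -> increment N (t m) (t m.+1) w =
    psum (fun i => increment (M i) (t m) (t m.+1)) n w.
  move=> mr; apply: increment_superposition => //; first exact: ltW.
  by apply: (vanish_le M_gcp (t0 m.+1) (tm _ _ mr) Hn).
by split => H m mr /=; have := H m mr; rewrite /= E.
Qed.

Lemma superposition_increment_cvg (s h : R) (c : nat) : 0 <= s -> 0 <= h ->
  convol (fun i b => pr (M i h @^-1` [set b])) n c @[n --> \oo] -->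
  pr (increment N s (s + h) @^-1` [set c]).
Proof.
move=> s0 h0; have sh0 : 0 <= s + h by rewrite addr_ge0.
have ssh : s <= s + h by rewrite lerDl.
rewrite (_ : (fun n => _) = fun n =>
  pr (psum (fun i => increment (M i) s (s + h)) n @^-1` [set c])); last first.
  by apply/funext => n; rewrite (prob_psum_increment M_gcp M_indep).
apply: (@prob_eventually_eq_cvg _ _ (s + h)) => //.
- by move=> n; apply: measurable_preimage_nat; exact: measurable_psum_increment.
- by apply: measurable_preimage_nat; exact: measurable_increment_superposition.
by move=> n w gw Hn; rewrite /= (increment_superposition gw s0 ssh Hn).
Qed.

Lemma cvg_prod_ord (f : nat -> nat -> R) (l : nat -> R) (r : nat) :
  (forall m, f m n @[n --> \oo] --> l m) ->
  \prod_(m < r) f m n @[n --> \oo] --> \prod_(m < r) l m.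
Proof.
move=> fl; elim: r => [|r IH].
  rewrite big_ord0 (_ : (fun n => _) = fun=> 1); first exact: cvg_cst.
  by apply/funext => n; rewrite big_ord0.
rewrite big_ord_recr (_ : (fun n => _) =
    fun n => (\prod_(m < r) f m n) * f r n); first exact: cvgM.
by apply/funext => n; rewrite big_ord_recr.
Qed.

(** For partial sums the joint probability is the product of the marginals. Both sides converge to
    their counterparts for the limit, and limits are unique. *)
Lemma superposition_independent_increments : independent_increments P N.
Proof.
move=> t t00 tS; have t0 m : 0 <= t m.
  by elim: m => // m; move/le_trans; apply; exact: ltW.
apply: mutually_independent_points => [m|r c].
  exact: measurable_increment_superposition.
rewrite -(cvg_lim _ (increment_superposition_cvg (r := r) (c := c) t00 tS))//.
apply: cvg_lim => //.
rewrite (_ : (fun n => _) = fun n => \prod_(m < r)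
    pr (psum (fun i => increment (M i) (t m) (t m.+1)) n
          @^-1` [set c m])); last first.
  by apply/funext => n; rewrite (prob_psum_increments_indep M_gcp M_indep).
apply: (@cvg_prod_ord
  (fun m n => pr (psum (fun i => increment (M i) (t m) (t m.+1)) n @^-1` [set c m]))
  (fun m => pr (increment N (t m) (t m.+1) @^-1` [set c m])) r) => m.
apply: (@prob_eventually_eq_cvg _ _ (t m.+1)) => //.
- by move=> n; apply: measurable_preimage_nat; exact: measurable_psum_increment.
- by apply: measurable_preimage_nat; exact: measurable_increment_superposition.
by move=> n w gw Hn; rewrite /= (increment_superposition gw (t0 m) (ltW (tS m)) Hn).
Qed.

(** Increments of length [h] from [s] and from [t] have point masses that are limits of one and the
    same sequence of convolutions. *)
Lemma superposition_stationary_increments : stationary_increments P N.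
Proof.
move=> s t h s0 t0 h0 C.
have mI u : 0 <= u -> measurable_fun setT (increment N u (u + h)).
  by move=> u0; apply: measurable_increment_superposition => //; rewrite addr_ge0.
rewrite !probE; try exact: measurable_preimage_nat (mI _ _).
congr EFin; apply: prob_eq_law; [exact: mI|exact: mI|] => b.
rewrite -(cvg_lim _ (superposition_increment_cvg (c := b) s0 h0))//.
by rewrite -(cvg_lim _ (superposition_increment_cvg (c := b) t0 h0)).
Qed.

End LimitIncrements.

(** * Jump rates of the superposition *)

Section LowerRate.
Context (R : realType).

(** The lower limit of [f h / h] as [h] decreases to 0 is at least [c]: one half of the asymptotics,
    stable under sums. *)
Definition lower_rate (f : R -> R) (c : R) : Prop :=
  forall e, 0 < e -> exists2 x, 0 < x &
    forall h, 0 < h -> h < x -> (c - e) * h <= f h.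

Lemma lower_rate_sum (s : seq nat) (f : nat -> R -> R) (c : nat -> R) :
  (forall j, j \in s -> lower_rate (f j) (c j)) ->
  lower_rate (fun h => \sum_(j <- s) f j h) (\sum_(j <- s) c j).
Proof.
elim: s => [|a s IH] H e e0.
  by exists 1 => // h h0 _; rewrite !big_nil; nra.
have e2 : 0 < e / 2 by rewrite divr_gt0.
have [x x0 Hx] := H a (mem_head _ _) _ e2.
have [|y y0 Hy] := IH _ _ e2; first by move=> j js; apply: H; rewrite inE js orbT.
exists (Num.min x y); first by rewrite lt_min x0.
move=> h h0; rewrite lt_min => /andP[hx hy]; rewrite !big_cons.
have := Hx h h0 hx; have := Hy h h0 hy; nra.
Qed.

Lemma is_o_h_eq (f g : R -> R) : (forall h, 0 < h -> f h = g h) ->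
  is_o_h f -> is_o_h g.
Proof.
move=> fg /is_o_hP H; apply/is_o_hP => e e0; have [x x0 Hx] := H e e0.
by exists x => // h h0 hx; rewrite -fg// Hx.
Qed.

Lemma cvg_sum_seq (s : seq nat) (f : nat -> nat -> R) (l : nat -> R) :
  (forall j, j \in s -> f j n @[n --> \oo] --> l j) ->
  \sum_(j <- s) f j n @[n --> \oo] --> \sum_(j <- s) l j.
Proof.
elim: s => [|a s IH] H.
  rewrite big_nil (_ : (fun n => _) = fun=> 0); first exact: cvg_cst.
  by apply/funext => n; rewrite big_nil.
rewrite big_cons (_ : (fun n => _) = fun n => f a n + \sum_(j <- s) f j n).
  apply: cvgD; first by apply: H; exact: mem_head.
  by apply: IH => j js; apply: H; rewrite inE js orbT.
by apply/funext => n; rewrite big_cons.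
Qed.

End LowerRate.

(** * Lower bounds for the jump probabilities *)

Section LimitAsymptotics.
Context (R : realType) (d : measure_display) (T : measurableType d).
Context (P : probability T R).
Local Notation pr := (prob P).

Lemma sum_prob_values_le1 (Y : T -> nat) (s : seq nat) :
  measurable_fun setT Y -> uniq s -> \sum_(j <- s) pr (Y @^-1` [set j]) <= 1.
Proof.
move=> mY us; have mYB C := measurable_preimage_nat C mY.
suff -> : \sum_(j <- s) pr (Y @^-1` [set j]) = pr (Y @^-1` [set` s]).
  exact: prob_le1.
elim: s us => [|a s IH] /=; first by rewrite big_nil set_nil preimage_set0 prob0.
move=> /andP[as_ us]; rewrite big_cons IH// -probU//.
  congr pr; apply/seteqP; split => w /=; rewrite inE.
    by case=> [->|->]; rewrite ?eqxx ?orbT.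
  by case/orP => [/eqP|]; [left|right].
by apply/disj_setPS => w [/= -> ays]; rewrite ays in as_.
Qed.

Context (M : nat -> R -> T -> nat) (k : nat -> nat) (lambda : nat -> nat -> R).
Context (K : nat) (b : nat -> R).
Hypothesis M_gcp : forall i, gcp P (k i) (lambda i) (M i).
Hypothesis M_indep : independent_processes P M.
Hypothesis lambda0 : forall i j, (k i < j)%N -> lambda i j = 0.
Hypothesis k_le : forall i, (k i <= K)%N.
Hypothesis lambda_cvg : forall j, (1 <= j <= K)%N ->
  \sum_(i < n) lambda i j @[n --> \oo] --> b j.
Local Notation Lam := (total_rate k lambda).
Local Notation N := (superposition M).
Let B := \sum_(1 <= j < K.+1) b j.

Lemma lambda_ge0 i j : (1 <= j)%N -> 0 <= lambda i j.
Proof.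
move=> j1; have [jk|kj] := leqP j (k i); last by rewrite lambda0.
by rewrite ltW// (gcp_rate_gt0 (M_gcp i))// j1.
Qed.

(** Padding with zero rates gives all processes the common range up to [K], so the sums over [i] and
    [j] can be exchanged. *)
Lemma total_rateE i : Lam i = \sum_(1 <= j < K.+1) lambda i j.
Proof.
rewrite /total_rate [RHS](@big_cat_nat _ _ _ (k i).+1)//=; last by rewrite ltnS.
rewrite [X in _ + X]big_nat_cond [X in _ + X]big1 ?addr0// => j.
by move=> /andP[/andP[kj _] _]; exact: lambda0.
Qed.

Lemma total_rate_cvg : \sum_(i < n) Lam i @[n --> \oo] --> B.
Proof.
rewrite (_ : (fun n => _) = fun n => \sum_(1 <= j < K.+1) \sum_(i < n) lambda i j).
  apply: (@cvg_sum_seq _ _ (fun j n => \sum_(i < n) lambda i j)) => j.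
  by rewrite mem_index_iota ltnS; exact: lambda_cvg.
apply/funext => n; rewrite exchange_big.
by apply: eq_bigr => i _; rewrite total_rateE.
Qed.
Local Notation Lam_cvg := total_rate_cvg.

Lemma sum_lambda_le j n : (1 <= j <= K)%N -> \sum_(i < n) lambda i j <= b j.
Proof.
move=> jK; rewrite -(cvg_lim _ (lambda_cvg jK))//.
apply: (nondecreasing_cvgn_le (u_ := fun n => \sum_(i < n) lambda i j)); last first.
  by apply/cvg_ex; exists (b j); exact: lambda_cvg.
apply/nondecreasing_seqP => m; rewrite big_ord_recr/= lerDl lambda_ge0//.
by case/andP: jK.
Qed.

Let mN h : 0 <= h -> measurable_fun setT (N h).
Proof. exact: (measurable_superposition M_gcp). Qed.

Let mNC h C : 0 <= h -> measurable (N h @^-1` C).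
Proof. by move=> h0; apply: measurable_preimage_nat; exact: mN. Qed.

Let mM i h C : 0 <= h -> measurable (M i h @^-1` C).
Proof. exact: (measurable_at M_gcp). Qed.

Let sum_Lam_le n : \sum_(i < n) Lam i <= B.
Proof. exact: (sum_total_rate_le M_gcp Lam_cvg). Qed.

(** Apply the tail bound from index 0: when no process has moved, the limit is 0, and on bad points
    it is 0 by convention. *)
Lemma superposition_zero_ge h : 0 <= h -> 1 - B * h <= pr (N h @^-1` [set 0%N]).
Proof.
move=> h0; rewrite lerBlDr -lerBlDl -probC; last exact: mNC.
have := prob_tail_le M_gcp 0 h0 sum_Lam_le; rewrite big_ord0 subr0.
apply: le_trans; apply: le_prob.
- by apply: measurableC; exact: mNC.
- exact: (measurable_tail M_gcp).
move=> w /= Nw; apply: contrapT => /tailP H; apply: Nw.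
have [gw|gw] := pselect (good M w); last exact: superposition_bad.
by rewrite (superpositionE gw h0 (n := 0))// /psum big_ord0.
Qed.

Lemma prob_pair_indep i l h (C D : set nat) : 0 <= h -> i != l ->
  pr (M i h @^-1` C `&` M l h @^-1` D) = pr (M i h @^-1` C) * pr (M l h @^-1` D).
Proof.
move=> h0 il; pose A x := if x == i then M i h @^-1` C else M l h @^-1` D.
have li : (l == i) = false by rewrite eq_sym (negbTE il).
have := @mutually_independent_seq _ _ _ P
  (fun i => sigma_process (M i)) [:: i; l] A.
rewrite !big_cons big_nil mulr1 /A eqxx li => <-//.
- congr pr; apply/seteqP; split => [w [Mi Ml] x|w Hw].
    by rewrite /= !inE => /orP[] /eqP ->; rewrite ?eqxx ?li.
  by split; [have := Hw i|have := Hw l]; rewrite /= !inE !eqxx ?li ?orbT; exact.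
- move=> x E; apply: sigma_process_measurable => t t0.
  exact: (gcp_measurable (M_gcp x)).
- by rewrite /= inE il.
- move=> x; rewrite !inE => /orP[] /eqP ->; rewrite ?eqxx ?li;
  exact: (sigma_process_at M_gcp).
Qed.

(* Exactly one process contributing a jump j, all others staying at 0: these
   events are disjoint and on each of them the superposition equals j. *)
Lemma superposition_jump_ge n j h : (1 <= j)%N -> 0 <= h ->
  (\sum_(i < n) pr (M i h @^-1` [set j])) * (1 - B * h) <= pr (N h @^-1` [set j]).
Proof.
move=> j1 h0.
(* Process [i] shows [j] while another process [l] has moved; the empty set at [l = i] lets the
   union run over all [l]. *)
pose C i l := if l == i then set0
  else M i h @^-1` [set j] `&` M l h @^-1` (~` [set 0%N]).
have mC i l : measurable (C i l).
  by rewrite /C; case: eqP => // _; apply: measurableI; exact: mM.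
have mUC i : measurable (\bigcup_l C i l) by exact: bigcup_measurable.
pose E (i : 'I_n) := M i h @^-1` [set j] `&` ~` \bigcup_l C i l.
have mE i : measurable (E i).
  by apply: measurableI; [exact: mM|exact: measurableC].
have EP (i : 'I_n) w (l : nat) : E i w -> l != i -> M l h w = 0%N.
  move=> [Mi Uw] li; apply: contrapT => Ml; apply: Uw.
  by exists l => //; rewrite /C (negbTE li).
have probE_ge (i : 'I_n) : pr (M i h @^-1` [set j]) * (1 - B * h) <= pr (E i).
  rewrite mulrBr mulr1 lerBlDr [leLHS](probID P (mM _ _ h0) (mUC i)) addrC lerD2l.
  (* By independence each [l] contributes at most the probability that [M i h] is [j] times
     [Lam l * h]. *)
  have : pr (\bigcup_l C i l) <= pr (M i h @^-1` [set j]) * (B * h).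
    apply: prob_bigcup_le => // m.
    apply: (@le_trans _ _ (\sum_(l < m) pr (M i h @^-1` [set j]) * (Lam l * h))).
      apply: ler_sum => l _; rewrite /C; case: eqP => [_|/eqP li].
        rewrite prob0 mulr_ge0 ?prob_ge0// mulr_ge0// ltW//.
        exact: (total_rate_gt0 M_gcp).
      rewrite prob_pair_indep// 1?eq_sym// ler_wpM2l ?prob_ge0//.
      exact: (gcp_nonzero_le (M_gcp l)).
    by rewrite -mulr_sumr -mulr_suml ler_wpM2l ?prob_ge0// ler_wpM2r.
  apply: le_trans; apply: le_prob => //.
  by apply: measurableI; [exact: mM|exact: mUC].
rewrite mulr_suml.
apply: (@le_trans _ _ (\sum_(i < n) pr (E i))).
  by apply: ler_sum => i _; exact: probE_ge.
rewrite -prob_sum//; last first.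
  move=> i i' _ _ [w [Ei Ei']]; apply/eqP/negPn/negP => ii'.
  have := EP i' w i Ei' ii'; case: Ei => /= -> _ j0.
  by rewrite j0 in j1.
have mg := measurableC (measurable_good M_gcp).
(* The null set of bad points is added on the right, since the limit is known to equal [j] only at
   good points. *)
rewrite -[leRHS]addr0 -(prob_good M_gcp Lam_cvg).
apply: le_trans (probU_le P (mNC _ h0) mg); apply: le_prob.
- by apply: fin_bigcup_measurable => //; exact: finite_finset.
- by apply: measurableU => //; exact: mNC.
move=> w [i _ Ei]; have [gw|] := pselect (good M w); last by right.
left; rewrite /= (superpositionE gw h0 (n := i.+1)); last first.
  by move=> l il; apply: (EP i) => //; rewrite gtn_eqF.
rewrite /psum big_ord_recr/= big1 ?add0n; first by case: Ei.
by move=> l _; apply: (EP i) => //; rewrite ltn_eqF.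
Qed.

Lemma gcp_lower_rate i j : (1 <= j)%N ->
  lower_rate (fun h => pr (M i h @^-1` [set j])) (lambda i j).
Proof.
move=> j1 e e0; have [jk|kj] := leqP j (k i); last first.
  exists 1 => // h h0 _; rewrite lambda0// sub0r.
  by apply: (@le_trans _ _ 0); [nra|exact: prob_ge0].
have jk' : (1 <= j <= k i)%N by rewrite j1.
have /is_o_hP/(_ e e0)[x x0 Hx] := gcp_asymp (M_gcp i) jk'.
exists x => // h h0 hx; have := Hx h h0 hx.
by rewrite ler_norml => /andP[+ _]; nra.
Qed.

(** Three errors of [e / 3] each: truncating the series for [b j], the asymptotics of the finitely
    many terms kept, and the quadratic loss [s * (B * h)]. *)
Lemma superposition_lower_rate j : (1 <= j <= K)%N ->
  lower_rate (fun h => pr (N h @^-1` [set j])) (b j).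
Proof.
move=> jK e e0; have j1 : (1 <= j)%N by case/andP: jK.
have e3 : 0 < e / 3 by rewrite divr_gt0.
have [n Hn] : exists n, b j - e / 3 <= \sum_(i < n) lambda i j.
  have /cvgrPdist_le/(_ _ e3) := lambda_cvg jK.
  move=> [n _ /(_ n (leqnn n))/=]; rewrite ler_norml => /andP[_ Hn].
  by exists n; lra.
have low : lower_rate (fun h => \sum_(i < n) pr (M i h @^-1` [set j]))
    (\sum_(i < n) lambda i j).
  rewrite -(big_mkord xpredT (fun i => lambda i j)).
  under eq_fun do rewrite -(big_mkord xpredT (fun i => pr (M i _ @^-1` [set j]))).
  apply: (lower_rate_sum (f := fun i h => pr (M i h @^-1` [set j]))) => i _.
  exact: gcp_lower_rate.
have [x x0 Hx] := low _ e3.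
have B1 : 0 < 3 * (B ^+ 2 + 1) by rewrite mulr_gt0// ltr_wpDl// sqr_ge0.
(* The second bound makes [B ^+ 2 * h] at most [e / 3]; the added 1 keeps the denominator positive
   when [B] is 0. *)
exists (Num.min x (e / (3 * (B ^+ 2 + 1)))); first by rewrite lt_min x0 divr_gt0.
move=> h h0; rewrite lt_min ltr_pdivlMr// => /andP[hx he].
have h0' := ltW h0.
have := superposition_jump_ge n j1 h0'; have := Hx h h0 hx.
set s := \sum_(i < n) pr _.
have sB : s <= B * h.
  apply: (@le_trans _ _ (\sum_(i < n) Lam i * h)); last first.
    by rewrite -mulr_suml ler_wpM2r.
  apply: ler_sum => i _; apply: le_trans (gcp_nonzero_le (M_gcp i) h0').
  apply: le_prob; [exact: mM|by apply: measurableC; exact: mM|].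
  by move=> w /= -> j0; rewrite j0 in j1.
have B0 : 0 <= B by have := sum_Lam_le 0; rewrite big_ord0.
move: (pr _) => q Hs Hq.
have h1 : s * (B * h) <= B ^+ 2 * h * h.
  rewrite (_ : B ^+ 2 * h * h = B * h * (B * h)); last by ring.
  by rewrite ler_wpM2r// mulr_ge0.
have h2 : B ^+ 2 * h * h <= e / 3 * h.
  have he' : B ^+ 2 * h * 3 + 3 * h < e.
    by rewrite (_ : _ + _ = h * (3 * (B ^+ 2 + 1)))//; ring.
  by rewrite ler_wpM2r//; lra.
have h3 : (b j - e / 3 - e / 3) * h <= s.
  by apply: le_trans Hs; rewrite ler_wpM2r//; lra.
nra.
Qed.

End LimitAsymptotics.

(** * The limit is a generalized counting process *)

Section LimitGcp.
Context (R : realType) (d : measure_display) (T : measurableType d).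
Context (P : probability T R).
Local Notation pr := (prob P).
Context (M : nat -> R -> T -> nat) (k : nat -> nat) (lambda : nat -> nat -> R).
Context (K : nat) (b : nat -> R).
Hypothesis M_gcp : forall i, gcp P (k i) (lambda i) (M i).
Hypothesis M_indep : independent_processes P M.
Hypothesis lambda0 : forall i j, (k i < j)%N -> lambda i j = 0.
Hypothesis k_le : forall i, (k i <= K)%N.
Hypothesis lambda_cvg : forall j, (1 <= j <= K)%N ->
  \sum_(i < n) lambda i j @[n --> \oo] --> b j.
Local Notation N := (superposition M).

Let Lam_cvg := total_rate_cvg lambda0 k_le lambda_cvg.

Let q j h := pr (N h @^-1` [set j]).
Let B := \sum_(1 <= j < K.+1) b j.

Let q_low (s : seq nat) : {subset s <= index_iota 1 K.+1} ->
  lower_rate (fun h => \sum_(j <- s) q j h) (\sum_(j <- s) b j).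
Proof.
move=> sK; apply: lower_rate_sum => j /sK; rewrite mem_index_iota ltnS => jK.
exact: (superposition_lower_rate M_gcp M_indep lambda0 k_le lambda_cvg).
Qed.

Let q_sum (s : seq nat) h : 0 <= h -> uniq s -> \sum_(j <- s) q j h <= 1.
Proof.
by move=> h0; apply: sum_prob_values_le1; exact: (measurable_superposition M_gcp).
Qed.

Let q0_ge h : 0 <= h -> 1 - B * h <= q 0%N h.
Proof. exact: (superposition_zero_ge M_gcp lambda0 k_le lambda_cvg). Qed.

Let zero_notin : 0%N \notin index_iota 1 K.+1.
Proof. by rewrite mem_index_iota. Qed.

(** The upper bound comes from total mass: values 1 to [K] already take at least [(B - e) * h]. *)
Lemma superposition_asymp0 : is_o_h (fun h => q 0%N h - (1 - B * h)).
Proof.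
apply/is_o_hP => e e0; have [x x0 Hx] := q_low (fun j => id) e0.
exists x => // h h0 hx; have := q0_ge (ltW h0); have := Hx h h0 hx.
have us : uniq (0%N :: index_iota 1 K.+1) by rewrite cons_uniq zero_notin iota_uniq.
have := q_sum (ltW h0) us; rewrite big_cons -/B => *.
by rewrite ler_norml; apply/andP; split; nra.
Qed.

(** For the upper bound, subtract from 1 the lower bounds for the value 0 and for all values up to
    [K] other than [j]. *)
Lemma superposition_asymp j : (1 <= j <= K)%N ->
  is_o_h (fun h => q j h - b j * h).
Proof.
move=> jK; have js : j \in index_iota 1 K.+1 by rewrite mem_index_iota ltnS.
apply/is_o_hP => e e0.
have [x x0 Hx] :=
  superposition_lower_rate M_gcp M_indep lambda0 k_le lambda_cvg jK e0.
have [y y0 Hy] := q_low (@mem_rem _ j (index_iota 1 K.+1)) e0.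
exists (Num.min x y); first by rewrite lt_min x0.
move=> h h0; rewrite lt_min => /andP[hx hy].
have := q0_ge (ltW h0); have := Hx h h0 hx; have := Hy h h0 hy.
have us : uniq (0%N :: index_iota 1 K.+1) by rewrite cons_uniq zero_notin iota_uniq.
have := q_sum (ltW h0) us; rewrite big_cons (big_rem j js)/=.
rewrite /B (big_rem j js)/= -/(q j h) => *.
by rewrite ler_norml; apply/andP; split; nra.
Qed.

(** The lower bounds for 0, ..., [K] leave mass at most [e * h] for any other value. *)
Lemma superposition_asymp_gt j : (K < j)%N -> is_o_h (q j).
Proof.
move=> Kj; apply/is_o_hP => e e0; have [x x0 Hx] := q_low (fun j => id) e0.
exists x => // h h0 hx; have := q0_ge (ltW h0); have := Hx h h0 hx.
have us : uniq [:: 0%N, j & index_iota 1 K.+1].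
  rewrite /= inE negb_or zero_notin iota_uniq mem_index_iota ltnS andbT.
  by rewrite [(j <= K)%N]leqNgt Kj andbF andbT eq_sym -lt0n (leq_trans _ Kj).
have := q_sum (ltW h0) us; rewrite !big_cons -/B => *.
by rewrite ger0_norm ?prob_ge0//; nra.
Qed.

(** The increment after [t] is independent of the one from 0 to [t], which is [N t] itself, and by
    stationarity has the law of [N h]. *)
Lemma superposition_cond_prob (t h : R) (n j : nat) : 0 <= t -> 0 < h ->
  P [set w | N t w = n] != 0%E ->
  cond_prob P [set w | N (t + h) w = (n + j)%N] [set w | N t w = n] = q j h.
Proof.
move=> t0 h0 Pn0; have N0 := superposition_start M_gcp.
(* Time 0 is treated apart, because the grid of times must increase strictly from 0 to [t]. *)
have [tE|tn0] := eqVneq t 0.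
  rewrite tE in Pn0 *; have nE : n = 0%N.
    apply/eqP; apply: contraT => n0.
    rewrite (_ : [set _ | _] = set0) ?measure0 ?eqxx// in Pn0.
    by apply/seteqP; split => // w /=; rewrite N0 => nE; rewrite -nE in n0.
  by rewrite nE cond_prob_at0.
have tgt0 : 0 < t by rewrite lt_neqAle eq_sym tn0.
(* The times needed are 0, [t] and [t + h]; further steps of [h] only complete the infinite
   sequence. *)
pose u m := if m is m'.+1 then t + h *+ m' else 0.
have uS m : u m < u m.+1.
  by case: m => [|m] /=; rewrite ?mulr0n ?addr0// ltrD2l mulrS ltrDr.
have ind := superposition_independent_increments M_gcp M_indep Lam_cvg (lexx 0) uS.
have inc0 s : increment N 0 s = N s.
  by apply/funext => w; rewrite /increment N0 subn0.
have um m : 0 <= u m by case: m => //= m; rewrite addr_ge0// mulrn_wge0// ltW.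
have mI m : measurable_fun setT (increment N (u m) (u m.+1)).
  exact: (measurable_increment_superposition M_gcp).
have := mutually_independent_ord 2
  (A := fun m => increment N (u m) (u m.+1)
                   @^-1` [set if m == 0%N then n else j]) _ ind.
have mono w : (N t w <= N (t + h) w)%N.
  have [_ mN _] := counting_superposition M_gcp.
  by apply: mN => //; rewrite lerDl ltW.
rewrite big_ord_recr big_ord1/= mulr0n mulr1n addr0 inc0.
rewrite (_ : \bigcap_(m < 2) _ =
    [set w | N (t + h) w = (n + j)%N] `&` [set w | N t w = n]).
  move=> H; rewrite /cond_prob -![fine (P _)]/(pr _) H.
  - rewrite mulrC mulKf; last first.
      apply: contra Pn0 => /eqP pn0; rewrite probE ?pn0//.
      apply: (measurable_preimage_nat [set n]).
      exact: (measurable_superposition M_gcp).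
    have := superposition_stationary_increments M_gcp M_indep Lam_cvg
      t0 (lexx 0) (ltW h0) [set j].
    by rewrite add0r inc0 /q /prob => ->.
  - by move=> i E /sigma_rvE[C ->]; exact: measurable_preimage_nat.
  - by move=> i; apply/sigma_rvE; eexists.
apply/seteqP; split => [w Hw|w [/= Nth Nt] [|[|//]] _ /=].
- have := Hw 0%N erefl; have := Hw 1%N erefl.
  rewrite /= mulr0n mulr1n addr0 inc0 /increment => jE nE; split => //=.
  by rewrite -jE -nE subnKC.
- by rewrite mulr0n addr0 inc0.
- by rewrite mulr0n mulr1n addr0 /increment Nth Nt addKn.
Qed.

Lemma gcp_superposition : (exists i, k i = K) -> gcp P K b N.
Proof.
move=> [i0 ki0]; split.
- split; first by have [[]] := M_gcp i0; rewrite ki0.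
  (* Positivity of [b j] comes from process [i0], which attains the maximum [K] and so has all its
     rates up to [K] positive. *)
  move=> j jK; apply: (@lt_le_trans _ _ (\sum_(i < i0.+1) lambda i j)); last first.
    exact: (sum_lambda_le M_gcp lambda0 lambda_cvg).
  rewrite big_ord_recr/= ltr_wpDl//.
    by apply: sumr_ge0 => i _; apply: (lambda_ge0 M_gcp lambda0); case/andP: jK.
  by apply: (gcp_rate_gt0 (M_gcp i0)); rewrite ki0.
- split; first exact: (counting_superposition M_gcp).
  exact: (superposition_start M_gcp).
- exact: (superposition_independent_increments M_gcp M_indep Lam_cvg).
- exact: (superposition_stationary_increments M_gcp M_indep Lam_cvg).
move=> t n t0 Pn0; split=> [|j jK|j Kj].
- apply: is_o_h_eq superposition_asymp0 => h h0.
  by rewrite superposition_cond_prob.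
- apply: is_o_h_eq (superposition_asymp jK) => h h0.
  by rewrite superposition_cond_prob.
- apply: is_o_h_eq (superposition_asymp_gt Kj) => h h0.
  by rewrite superposition_cond_prob.
Qed.

Lemma superposition_series_cvg (w : T) (t : R) : good M w -> 0 <= t ->
  series (fun i => (M i t w)%:R) n @[n --> \oo] --> ((N t w)%:R : R).
Proof.
move=> gw t0; have [n Hn] := goodP M_gcp gw t0.
apply: cvg_near_cst; exists n => // m /= nm.
rewrite (superpositionE (n := m) gw t0) => [|i mi]; last first.
  by rewrite Hn// (leq_trans nm).
by rewrite /series/= big_mkord /psum natr_sum.
Qed.

Lemma ae_good : \forall w \ae P, good M w.
Proof.
exists (~` good M); split => //; first exact: measurableC (measurable_good M_gcp).
have mg := measurableC (measurable_good M_gcp).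
by rewrite probE// (prob_good M_gcp Lam_cvg).
Qed.

End LimitGcp.

(** * Divergence *)

Section Divergence.
Context (R : realType) (d : measure_display) (T : measurableType d).
Context (P : probability T R).
Local Notation pr := (prob P).
Context (M : nat -> R -> T -> nat) (k : nat -> nat) (lambda : nat -> nat -> R).
Hypothesis M_gcp : forall i, gcp P (k i) (lambda i) (M i).
Hypothesis M_indep : independent_processes P M.
Local Notation Lam := (total_rate k lambda).
Hypothesis Lam_unbounded : forall x, exists n, x < \sum_(i < n) Lam i.

(** Restrict to the indices from [n] to [m] and multiply the exponential bounds by independence. *)
Lemma prob_no_tail_le (t : R) (n m : nat) : 0 < t ->
  pr (~` tail_event M n t) <= expR (- (t / 2 * \sum_(n <= i < m) Lam i)).
Proof.
move=> t0; have t0' := ltW t0.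
apply: (@le_trans _ _
    (pr (\bigcap_(i in [set` index_iota n m]) M i t @^-1` [set 0%N]))).
  apply: le_prob.
  - by apply: measurableC; exact: (measurable_tail M_gcp).
  - by apply: bigcap_measurableType => i _; exact: (measurable_at M_gcp).
  move=> w /tailP Hw i /=; rewrite mem_index_iota => /andP[ni _]; exact: Hw.
rewrite (mutually_independent_seq (F := fun i => sigma_process (M i))) ?iota_uniq//.
- rewrite -mulrN -sumrN mulr_sumr expR_sum; apply: ler_prod => i _.
  rewrite prob_ge0/=; apply: le_trans (gcp_zero_le (M_gcp i) t0) _.
  by rewrite ler_expR /total_rate; lra.
- move=> i E; apply: sigma_process_measurable => s s0.
  exact: (gcp_measurable (M_gcp i)).
- by move=> i _; exact: (sigma_process_at M_gcp).
Qed.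

Lemma prob_no_tail0 (t : R) (n : nat) : 0 < t -> pr (~` tail_event M n t) = 0.
Proof.
move=> t0; apply/eqP; rewrite eq_le prob_ge0 andbT leNgt; apply/negP.
set v := pr _ => v0.
(* The excess [2 / (t * v)] makes the exponent at least [v^-1]; as [expR x] exceeds [x], the bound
   falls below [v], a contradiction. *)
have [m Hm] := Lam_unbounded (\sum_(i < n) Lam i + 2 / (t * v)).
(* Positive rates make the partial sums increase, so exceeding the sum up to [n] forces [m] past
   [n]. *)
have nm : (n <= m)%N.
  rewrite leqNgt; apply/negP => mn; move: Hm; apply/negP; rewrite -leNgt.
  rewrite -!(big_mkord xpredT Lam) (big_cat_nat (leq0n m) (ltnW mn))/=.
  rewrite -addrA lerDl; apply: addr_ge0.
    by apply: sumr_ge0 => i _; rewrite ltW// (total_rate_gt0 M_gcp).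
  by rewrite divr_ge0// mulr_ge0// ltW.
have S : v^-1 <= t / 2 * \sum_(n <= i < m) Lam i.
  move: Hm; rewrite -!(big_mkord xpredT Lam) (big_cat_nat (leq0n n) nm)/= ltrD2l.
  move=> /ltW H; have t2 : 0 <= t / 2 by rewrite divr_ge0 ?ltW.
  have := ler_wpM2l t2 H; apply: le_trans.
  rewrite le_eqVlt; apply/orP; left; apply/eqP; field.
  by rewrite !gt_eqF.
have := prob_no_tail_le n m t0; rewrite -/v expRN leNgt; apply/negP; rewrite negbK.
rewrite invf_plt ?posrE ?expR_gt0//; apply: lt_le_trans (expR_ge1Dx _).
by apply: le_lt_trans S _; rewrite ltrDr.
Qed.

(** Terms of a convergent series tend to 0, and natural numbers below 1 vanish; convergence
    therefore puts [w] outside some tail event. *)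
Lemma series_diverges (t : R) : 0 < t ->
  \forall w \ae P, ~ cvgn (series (fun i => (M i t w)%:R : R)).
Proof.
move=> t0; have t0' := ltW t0.
have mC n : measurable (~` tail_event M n t).
  by apply: measurableC; exact: (measurable_tail M_gcp).
exists (\bigcup_n ~` tail_event M n t); split.
- exact: bigcup_measurable.
- apply/eqP; rewrite probE; last exact: bigcup_measurable.
  rewrite eqe eq_le prob_ge0 andbT; apply: prob_bigcup_le => // n.
  by rewrite big1// => i _; rewrite prob_no_tail0.
move=> w /contrapT /cvg_series_cvg_0/cvgrPdist_lt/(_ 1 ltr01)[n _ Hn].
exists n => //; apply/tailP => i ni.
have := Hn i ni; rewrite /= sub0r normrN normr_nat (ltr_nat R _ 1) ltnS leqn0.
by move/eqP.
Qed.

End Divergence.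

(** * From extended-real series to real partial sums *)

Lemma nneseries_fine_cvg (R : realType) (u : nat -> R) :
  (forall i, 0 <= u i) -> (\sum_(0 <= i <oo) (u i)%:E < +oo)%E ->
  \sum_(i < n) u i @[n --> \oo] --> fine (\sum_(0 <= i <oo) (u i)%:E)%E.
Proof.
move=> u0 uoo.
have : (\sum_(0 <= i < n) (u i)%:E)%E @[n --> \oo] -->
    (\sum_(0 <= i <oo) (u i)%:E)%E.
  by apply: is_cvg_nneseries => i _ _; rewrite lee_fin.
rewrite -[X in _ --> X]fineK; last first.
  by rewrite ge0_fin_numE//; apply: nneseries_ge0 => i _ _; rewrite lee_fin.
move=> /fine_cvgP[_]; rewrite (_ : fine \o _ = fun n => \sum_(i < n) u i)//.
by apply/funext => n /=; rewrite sumEFin/= big_mkord.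
Qed.

Lemma nneseries_pinfty_unbounded (R : realType) (u : nat -> R) :
  (forall i, 0 <= u i) -> (\sum_(0 <= i <oo) (u i)%:E = +oo)%E ->
  forall x, exists n, x < \sum_(i < n) u i.
Proof.
move=> u0 uoo x; apply: contrapT => /forallNP H.
suff : (\sum_(0 <= i <oo) (u i)%:E <= x%:E)%E by rewrite uoo leye_eq.
apply: lime_le; first by apply: is_cvg_nneseries => i _ _; rewrite lee_fin.
apply: nearW => n; rewrite sumEFin lee_fin big_mkord leNgt; exact/negP.
Qed.

Theorem theorem2p1 (R : realType) (d : measure_display) (T : measurableType d)
    (P : probability T R)
    (M : nat -> R -> T -> nat) (k : nat -> nat) (lambda : nat -> nat -> R)
    (K : nat)
    (M_gcp : forall i, gcp P (k i) (lambda i) (M i))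
    (M_indep : independent_processes P M)
    (lambda0 : forall i j, (k i < j)%N -> lambda i j = 0)
    (k_mono : forall i, (k i <= k i.+1)%N)
    (K_max : (exists i, k i = K) /\ (forall i, (k i <= K)%N)) :
  let beta (j : nat) : \bar R := (\sum_(0 <= i <oo) (lambda i j)%:E)%E in
  let Msum (t : R) (w : T) : R^nat := series (fun i => (M i t w)%:R) in
  ((forall j, (1 <= j <= K)%N -> (beta j < +oo)%E) ->
     (forall t : R, 0 <= t -> \forall w \ae P, cvgn (Msum t w)) /\
     (exists2 N : R -> T -> nat,
        (\forall w \ae P, forall t : R, 0 <= t ->
           Msum t w n @[n --> \oo] --> ((N t w)%:R : R))
        & gcp P K (fun j => fine (beta j)) N)) /\
  ((exists2 j, (1 <= j <= K)%N & beta j = +oo%E) ->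
     forall t : R, 0 < t -> \forall w \ae P, ~ cvgn (Msum t w)).
Proof.
have [K_attained k_le] := K_max.
have lam0 j : (1 <= j)%N -> forall i, 0 <= lambda i j.
  by move=> j1 i; exact: (lambda_ge0 M_gcp lambda0).
move=> beta Msum; split.
  move=> beta_fin.
  have lam_cvg j : (1 <= j <= K)%N ->
      \sum_(i < n) lambda i j @[n --> \oo] --> fine (beta j).
    move=> jK; apply: nneseries_fine_cvg; last exact: beta_fin.
    by apply: lam0; case/andP: jK.
  have aeG := ae_good M_gcp lambda0 k_le lam_cvg.
  split.
    move=> t t0; apply: filterS aeG => w gw.
    apply/cvg_ex; exists ((superposition M t w)%:R).
    exact: (superposition_series_cvg M_gcp gw t0).
  exists (superposition M).
    (* [good] does not depend on [t], so one null set serves all times. *)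
    apply: filterS aeG => w gw t t0.
    exact: (superposition_series_cvg M_gcp gw t0).
  exact: (gcp_superposition M_gcp M_indep lambda0 k_le lam_cvg K_attained).
move=> [j jK betaj] t t0; apply: (series_diverges M_gcp M_indep _ t0) => x.
have j1 : (1 <= j)%N by case/andP: jK.
have [n Hn] := nneseries_pinfty_unbounded (lam0 j j1) betaj x.
(* Each total rate dominates its component [lambda i j], so divergence of one [beta j] makes the
   summed total rates unbounded. *)
exists n; apply: lt_le_trans Hn _; apply: ler_sum => i _.
rewrite (total_rateE lambda0 k_le) (bigD1_seq j) ?iota_uniq//=; last first.
  by rewrite mem_index_iota ltnS.
rewrite lerDl big_seq_cond sumr_ge0// => l; rewrite mem_index_iota.
by move=> /andP[/andP[l1 _] _]; exact: lam0.
Qed.
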